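(* Let $V$ be a complex vector space of dimension $4$ with a symplectic form $\omega$, let $Z=\{B\in\mathfrak{sp}(V): B^2=0\}$, let $Z_{\mathrm{sing}}\subset Z$ be its singular locus (with ideal generated by the $2\times 2$-minors of $B$), and let $\sigma:\widetilde Z\to Z$ be the resolution given by $\widetilde Z=\{(B,U)\in Z\times G: B(U)=0\}$, $\sigma(B,U)=B$, where $G$ is the Grassmannian of maximal isotropic (Lagrangian) subspaces $U\subset V$. Then the resolution $\sigma:\widetilde Z\to Z$ is isomorphic to the blow-up of $Z$ along $Z_{\mathrm{sing}}\subset Z$.
   Context: $\mathfrak{sp}(V)$ is the symplectic Lie algebra of $(V,\omega)$. $Z\subset\mathfrak{sp}(V)$ is the subvariety whose ideal $I_0\subset\mathbb{C}[\mathfrak{sp}(V)]$ is generated by the coefficients of the matrix $B^2$ (these span a space of $6$ quadrics). The singular locus $Z_{\mathrm{sing}}$ consists of the $B\in Z$ of rank $\le 1$; its ideal $L_0$ is generated by the coefficients of $\Lambda^2B$, i.e. the $2\times2$-minors of $B$. The variety $\widetilde Z$ is smooth, being isomorphic over $G$ to the cotangent bundle $T^*G$. *)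

(* Defs.v *)
From HB Require Import structures.
From mathcomp Require Import all_boot all_order all_algebra.
From mathcomp Require Import sesquilinear.
From mathcomp Require Import boolp classical_sets reals.
From mathcomp Require Import complex.

Set Implicit Arguments.
Unset Strict Implicit.
Unset Printing Implicit Defensive.

Import Order.TTheory GRing.Theory Num.Theory.

Local Open Scope classical_set_scope.
Local Open Scope ring_scope.

(* The algebra K[W] of polynomial functions on W: the algebra of functions
   generated by the linear forms.  For K infinite it is the symmetric algebra
   of the dual of W. *)
Inductive polyfun (K : fieldType) (W : vectType K) : (W -> K) -> Prop :=
| polyfun_const (c : K) : polyfun (fun _ => c)
| polyfun_form (l : 'Hom(W, K^o)) : polyfun (fun x => l x)
| polyfun_add (f g : W -> K) :
    polyfun f -> polyfun g -> polyfun (fun x => f x + g x)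
| polyfun_mul (f g : W -> K) :
    polyfun f -> polyfun g -> polyfun (fun x => f x * g x).

(* The ideal of Y in K[X] (Y a subset of X, X a subset of W) is generated by
   the restrictions to X of the f i. *)
Definition generates_ideal (K : fieldType) (W : vectType K) (I : finType)
    (X Y : set W) (f : I -> W -> K) : Prop :=
  forall g : W -> K, polyfun g ->
    (forall y, Y y -> g y = 0) <->
    (exists a : I -> W -> K, (forall i, polyfun (a i)) /\
       (forall x, X x -> g x = \sum_(i : I) a i x * f i x)).

(* v is tangent to X at p: every g in the ideal of X vanishes to order at least
   two at t = 0 along the line p + t v. *)
Definition tangent (K : fieldType) (W : vectType K) (X : set W) (p v : W) :
    Prop :=
  forall g : W -> K, polyfun g -> (forall x, X x -> g x = 0) ->
    exists q : {poly K}, forall t : K, g (p + t *: v) = t ^+ 2 * q.[t].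

Definition is_tangent_space (K : fieldType) (W : vectType K) (X : set W)
    (p : W) (T : {vspace W}) : Prop :=
  forall v, v \in T <-> tangent X p v.

(* The singular locus of an irreducible closed subvariety X of W: the points at
   which the dimension of the Zariski tangent space exceeds its minimum on X
   (the minimum being the dimension of X). *)
Definition singular_locus (K : fieldType) (W : vectType K) (X : set W) :
    set W :=
  [set p | X p /\ exists (q : W) (Tp Tq : {vspace W}),
     [/\ X q, is_tangent_space X p Tp, is_tangent_space X q Tq &
         (\dim Tq < \dim Tp)%N]].

(* A variety in the sense of Serre: a space together with its sheaf of
   K-valued regular functions; only the values of a regular function on the
   given open set are relevant. *)
Record space_with_functions (K : fieldType) := SpaceWithFunctions {
  points :> Type;
  is_open : set points -> Prop;
  is_regular : set points -> (points -> K) -> Prop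
}.

Definition is_morphism (K : fieldType) (S T : space_with_functions K)
    (phi : S -> T) : Prop :=
  (forall O : set T, is_open O -> is_open (phi @^-1` O)) /\
  (forall (O : set T) (g : T -> K), is_open O -> is_regular O g ->
     is_regular (phi @^-1` O) (g \o phi)).

Definition is_isomorphism (K : fieldType) (S T : space_with_functions K)
    (phi : S -> T) : Prop :=
  is_morphism phi /\
  exists psi : T -> S, [/\ is_morphism psi, cancel phi psi & cancel psi phi].

(* The structure on X pushed forward from pi^-1(X), a subset of the affine space
   W, along pi : W -> A.  A subset of X is open iff its preimage is Zariski open
   in pi^-1(X), and a function on it is regular iff its pullback is, i.e. iff the
   pullback is locally a quotient of polynomials.  This is used below with pi the
   map from homogeneous coordinates to projective space and the map from
   2-frames to a Grassmannian.  These are the quotients by GL_1 and GL_2, and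
   are Zariski locally trivial, so that for X closed this is the usual structure
   of closed subvariety. *)
Definition coordinate_space (K : fieldType) (W : vectType K) (A : Type)
    (pi : W -> A) (X : set A) : space_with_functions K :=
  @SpaceWithFunctions K X
    (fun O => forall (x : X) (w : W), O x -> pi w = val x ->
       exists h : W -> K, [/\ polyfun h, h w != 0 &
         forall (x' : X) (w' : W), pi w' = val x' -> h w' != 0 -> O x'])
    (fun O g => forall (x : X) (w : W), O x -> pi w = val x ->
       exists a b : W -> K, [/\ polyfun a, polyfun b, b w != 0 &
         forall (x' : X) (w' : W), O x' -> pi w' = val x' -> b w' != 0 ->
           g x' = a w' / b w']).

(* The point of W x P(E) with coordinates (x, y), y <> 0; P(E) is the set of
   lines in E. *)
Definition line_point (K : fieldType) (W E : vectType K) (xy : W * E) :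
    W * {vspace E} := (xy.1, <[xy.2]>%VS).

(* F in K[W x E] is homogeneous of degree d in the second variable (K
   infinite). *)
Definition homogeneous_snd (K : fieldType) (W E : vectType K) (d : nat)
    (F : W * E -> K) : Prop :=
  forall (x : W) (y : E) (c : K), F (x, c *: y) = c ^+ d * F (x, y).

(* Blow-up of X along the ideal L = (f i)_i of K[X], as a subset of X x P(E)
   with E = K^I.  The Rees algebra, the direct sum of the L^d t^d, is the quotient
   of K[X][T_i, i in I] by the kernel of T_i |-> f_i t; a T-homogeneous F is in
   this kernel iff F(x, (f_i(x))_i) = 0 on X.  The blow-up is the Proj of the
   Rees algebra, that is, the set of common zeros of these F. *)
Definition blowup_set (K : fieldType) (W : vectType K) (I : finType)
    (X : set W) (f : I -> W -> K) : set (W * {vspace {ffun I -> K^o}}) :=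
  [set xl | [/\ X xl.1, \dim xl.2 = 1%N &
    forall (d : nat) (F : W * {ffun I -> K^o} -> K),
      polyfun F -> homogeneous_snd d F ->
      (forall x, X x -> F (x, [ffun i => f i x]) = 0) ->
      forall y, y \in xl.2 -> F (xl.1, y) = 0]].

Definition blowup (K : fieldType) (W : vectType K) (I : finType)
    (X : set W) (f : I -> W -> K) : space_with_functions K :=
  coordinate_space (@line_point K W {ffun I -> K^o}) (blowup_set X f).

Definition blowdown (K : fieldType) (W : vectType K) (I : finType)
    (X : set W) (f : I -> W -> K) (p : blowup X f) : W :=
  (val (p : blowup_set X f)).1.

Definition sp_alg (K : fieldType) (V : vectType K)
    (omega : {skew_symmetric V}) : set 'End(V) :=
  [set B | forall u v, omega (B u) v + omega u (B v) = 0].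

(* For \dim V = 4 it is irreducible: the closure of the set of its elements of
   rank 2, which form one orbit of the symplectic group if K is algebraically
   closed of characteristic other than 2. *)
Definition square_zero (K : fieldType) (V : vectType K)
    (omega : {skew_symmetric V}) : set 'End(V) :=
  [set B | sp_alg omega B /\ (B \o B)%VF = 0].

Definition isotropic (K : fieldType) (V : vectType K)
    (omega : {skew_symmetric V}) (U : {vspace V}) : Prop :=
  (U <= orthov omega U)%VS.

Definition maximal_isotropic (K : fieldType) (V : vectType K)
    (omega : {skew_symmetric V}) (U : {vspace V}) : Prop :=
  isotropic omega U /\
  forall U' : {vspace V}, isotropic omega U' -> (U <= U')%VS -> U' = U.

Definition Ztilde_set (K : fieldType) (V : vectType K)
    (omega : {skew_symmetric V}) : set ('End(V) * {vspace V}) :=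
  [set BU | [/\ square_zero omega BU.1, maximal_isotropic omega BU.2 &
               (BU.1 @: BU.2)%VS = 0%VS]].

Definition frame_point (K : fieldType) (W V : vectType K)
    (xu : W * (V * V)) : W * {vspace V} :=
  (xu.1, <<[:: xu.2.1; xu.2.2]>>%VS).

(* Meant for \dim V = 4: maximal isotropic subspaces then have dimension 2 and
   are described by 2-frames. *)
Definition Ztilde (K : fieldType) (V : vectType K)
    (omega : {skew_symmetric V}) : space_with_functions K :=
  coordinate_space (@frame_point K 'End(V) V) (Ztilde_set omega).

Definition sigma (K : fieldType) (V : vectType K)
    (omega : {skew_symmetric V}) (p : Ztilde omega) : 'End(V) :=
  (val (p : Ztilde_set omega)).1.

Definition matrix_in_basis (K : fieldType) (V : vectType K) (n : nat)
    (e : n.-tuple V) (B : 'End(V)) : 'M[K]_n :=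
  \matrix_(i, j) coord e i (B e`_j).

(* The 2x2-minors of B with rows r 0, r 1 and columns c 0, c 1.  The maps r and c
   are arbitrary, so each minor occurs up to sign, together with zeros. *)
Definition minor2 (K : fieldType) (V : vectType K) (n : nat) (e : n.-tuple V)
    (rc : {ffun 'I_2 -> 'I_n} * {ffun 'I_2 -> 'I_n}) (B : 'End(V)) : K :=
  \det (mxsub rc.1 rc.2 (matrix_in_basis e B)).

(* Main.v *)
Require Import Defs.
From HB Require Import structures.
From mathcomp Require Import all_boot all_order all_algebra.
From mathcomp Require Import sesquilinear.
From mathcomp Require Import boolp classical_sets reals.
From mathcomp Require Import complex.
From mathcomp Require Import ring.

Set Implicit Arguments.
Unset Strict Implicit.
Unset Printing Implicit Defensive.

Import Order.TTheory GRing.Theory Num.Theory.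

Local Open Scope classical_set_scope.
Local Open Scope ring_scope.

(** Fix a basis of V with Gram matrix J.  Writing the matrix of an endomorphism as
    S J identifies sp(V) with the symmetric matrices S, and Z with those such that
    S J S = 0.  A point B of Z has isotropic image, and every Lagrangian plane U
    containing the image is killed by B; if F is the matrix of a basis of U, then
    S = F s F^T with s symmetric of size 2 ([square_zero_normal_form]).  The rank
    of B is that of s.

    Singular locus.  Complete F by G to a symplectic basis.  If s is invertible,
    the linear equations obtained from B^2 = 0 have a solution space of dimension
    6 ([anticommutant_param]), all of which consists of tangent vectors: one moves
    s, or the plane by F + t G k with k symmetric ([frame_dir_tangent]).  At a
    multiple of a square a a^T there are seven independent tangent vectors
    ([rank1_tangent], [singular_dir_inj]).  Hence the singular points are those of
    rank at most one ([singular_rank1], [singular_det0]).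

    Its ideal.  Modulo the 2x2 minors, a monomial in the entries of S only depends
    on the multiset of its indices ([pair_monomial_perm]), and on the matrices
    v v^T different multisets give different monomials in v.  So a polynomial
    vanishing on all v v^T is congruent to zero ([veronese_ideal]).

    Blow-up.  The vector of minors of F s F^T J is det s times a vector m(F) which
    is non-zero and, up to a scalar, only depends on the plane U.  The isomorphism
    maps (B, U) to (B, [m(F)]).  This point lies in the blow-up because s is a
    limit of invertible matrices ([minors_square_zero_frame]).  Conversely, two
    vectors with coordinates among those of y span the image of B when y is the
    vector of minors of B and a given minor does not vanish ([minor_frame]).
    That they span a Lagrangian plane killed by B, with y proportional to m of
    that plane, is a system of relations homogeneous in y, so it persists on the
    whole blow-up ([blowup_point_frame]).  Both maps are given locally by
    polynomials in homogeneous coordinates and frames, hence are morphisms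
    ([local_lift_morphism]), and they are inverse to each other. *)

(** * Polynomial functions and polynomial maps *)

Lemma det_mx2 (R : comNzRingType) (A : 'M[R]_2) :
  \det A = A 0 0 * A 1 1 - A 0 1 * A 1 0.
Proof.
rewrite (expand_det_row _ 0) !big_ord_recl big_ord0 addr0 /cofactor !det_mx11.
rewrite !mxE /= expr0 expr1 mul1r mulN1r mulrN.
have A_ i j i' j' : val i = val i' -> val j = val j' -> A i j = A i' j'.
  by move=> /val_inj -> /val_inj ->.
by congr (_ * _ - _ * _); apply: A_.
Qed.

Section PolynomialFunctions.
Variable K : fieldType.
Implicit Types (W : vectType K).

Lemma eq_polyfun W (f g : W -> K) : f =1 g -> polyfun f -> polyfun g.
Proof. by move=> fg; rewrite (_ : f = g) //; apply/funext. Qed.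

Lemma polyfun_linear W (f : W -> K) :
  (forall (a : K) (u v : W), f (a *: u + v) = a * f u + f v) -> polyfun f.
Proof.
move=> hf; pose F : {linear W -> K^o} := HB.pack (f : W -> K^o)
  (GRing.isLinear.Build K W K^o *:%R f hf).
by apply: (@eq_polyfun _ (linfun F)) (polyfun_form _) => x; rewrite lfunE.
Qed.

Lemma polyfun_opp W (f : W -> K) : polyfun f -> polyfun (fun x => - f x).
Proof.
move=> hf; apply: (@eq_polyfun _ (fun x => -1 * f x)) => [x|].
  by rewrite mulN1r.
by apply: polyfun_mul => //; apply: polyfun_const.
Qed.

Lemma polyfun_sub W (f g : W -> K) :
  polyfun f -> polyfun g -> polyfun (fun x => f x - g x).
Proof. by move=> hf hg; apply: polyfun_add => //; apply: polyfun_opp. Qed.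

Lemma polyfun_sum W (I : Type) (r : seq I) (P : pred I) (f : I -> W -> K) :
  (forall i, polyfun (f i)) -> polyfun (fun x => \sum_(i <- r | P i) f i x).
Proof.
move=> hf; elim: r => [|i r IH].
  by apply: eq_polyfun (polyfun_const _ 0) => x; rewrite big_nil.
case Pi: (P i); last by apply: eq_polyfun IH => x; rewrite big_cons Pi.
apply: (@eq_polyfun _ _ _ _ (polyfun_add (hf i) IH)) => x.
by rewrite big_cons Pi.
Qed.

Lemma polyfun_prod W (I : Type) (r : seq I) (P : pred I) (f : I -> W -> K) :
  (forall i, polyfun (f i)) -> polyfun (fun x => \prod_(i <- r | P i) f i x).
Proof.
move=> hf; elim: r => [|i r IH].
  by apply: eq_polyfun (polyfun_const _ 1) => x; rewrite big_nil.
case Pi: (P i); last by apply: eq_polyfun IH => x; rewrite big_cons Pi.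
apply: (@eq_polyfun _ _ _ _ (polyfun_mul (hf i) IH)) => x.
by rewrite big_cons Pi.
Qed.

Definition polymap W W' (phi : W -> W') : Prop :=
  forall l : 'Hom(W', K^o), polyfun (fun x => l (phi x)).

Lemma polyfun_comp W W' (phi : W -> W') (g : W' -> K) :
  polymap phi -> polyfun g -> polyfun (g \o phi).
Proof.
move=> hphi; elim=> [c|l|f g' _ hf _ hg|f g' _ hf _ hg].
- exact: polyfun_const.
- exact: hphi.
- exact: polyfun_add.
- exact: polyfun_mul.
Qed.

Lemma polymap_sum W W' (I : finType) (c : I -> W -> K) (w : I -> W') phi :
  (forall x, phi x = \sum_i c i x *: w i) -> (forall i, polyfun (c i)) ->
  polymap phi.
Proof.
move=> hphi hc l.
apply: (@eq_polyfun _ (fun x => \sum_i c i x * l (w i))) => [x|].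
  by rewrite hphi linear_sum; apply: eq_bigr => i _; rewrite linearZ.
apply: polyfun_sum => i; apply: polyfun_mul => //; exact: polyfun_const.
Qed.

Lemma polymap_lin W W' (phi : W -> W') :
  (forall (a : K) (u v : W), phi (a *: u + v) = a *: phi u + phi v) ->
  polymap phi.
Proof.
by move=> hphi l; apply: polyfun_linear => a u v; rewrite hphi linearP.
Qed.

Lemma polymap_pair W W1 W2 (f : W -> W1) (g : W -> W2) :
  polymap f -> polymap g -> polymap (fun x => (f x, g x)).
Proof.
move=> hf hg l.
have hl1 : polyfun (fun y : W1 => l (y, 0)).
  apply: polyfun_linear => a u v; rewrite (_ : (_, 0) = a *: (u, 0) + (v, 0)).
    by rewrite linearP.
  by congr (_, _); rewrite /= scaler0 addr0.
have hl2 : polyfun (fun y : W2 => l (0, y)).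
  apply: polyfun_linear => a u v; rewrite (_ : (0, _) = a *: (0, u) + (0, v)).
    by rewrite linearP.
  by congr (_, _); rewrite /= scaler0 addr0.
apply: (@eq_polyfun _ (fun x => l (f x, 0) + l (0, g x))) => [x|].
  rewrite -linearD (_ : _ + _ = (f x, g x)) //; congr (_, _) => /=.
    by rewrite addr0.
  by rewrite add0r.
apply: polyfun_add; [exact: (polyfun_comp hf hl1)|exact: (polyfun_comp hg hl2)].
Qed.

Definition polymx W m n (A : W -> 'M[K]_(m, n)) : Prop :=
  forall i j, polyfun (fun x => A x i j).

Lemma polymx_const W m n (A : 'M[K]_(m, n)) : polymx (fun _ : W => A).
Proof. by move=> i j; apply: polyfun_const. Qed.

Lemma polymx_add W m n (A B : W -> 'M[K]_(m, n)) :
  polymx A -> polymx B -> polymx (fun x => A x + B x).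
Proof.
move=> hA hB i j; apply: eq_polyfun (polyfun_add (hA i j) (hB i j)) => x.
by rewrite mxE.
Qed.

Lemma polymx_mul W m n p (A : W -> 'M[K]_(m, n)) (B : W -> 'M[K]_(n, p)) :
  polymx A -> polymx B -> polymx (fun x => A x *m B x).
Proof.
move=> hA hB i j.
apply: (@eq_polyfun _ (fun x => \sum_k A x i k * B x k j)) => [x|].
  by rewrite mxE.
by apply: polyfun_sum => k; apply: polyfun_mul.
Qed.

Lemma polymx_tr W m n (A : W -> 'M[K]_(m, n)) :
  polymx A -> polymx (fun x => (A x)^T).
Proof. by move=> hA i j; apply: eq_polyfun (hA j i) => x; rewrite mxE. Qed.

Lemma polymx_sub W m n m' n' (f : 'I_m' -> 'I_m) (g : 'I_n' -> 'I_n)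
    (A : W -> 'M[K]_(m, n)) :
  polymx A -> polymx (fun x => mxsub f g (A x)).
Proof. by move=> hA i j; apply: eq_polyfun (hA (f i) (g j)) => x; rewrite mxE. Qed.

Lemma polyfun_det W n (A : W -> 'M[K]_n) :
  polymx A -> polyfun (fun x => \det (A x)).
Proof.
move=> hA; apply: polyfun_sum => s; apply: polyfun_mul.
  exact: polyfun_const.
by apply: polyfun_prod => i; apply: hA.
Qed.

Lemma polyfun_curve (f : K^o -> K) :
  polyfun f -> exists q : {poly K}, forall t, f t = q.[t].
Proof.
elim=> [c|l|g h _ [p hp] _ [q hq]|g h _ [p hp] _ [q hq]].
- by exists c%:P => t; rewrite hornerC.
- exists ((l (1 : K^o))%:P * 'X) => t.
  by rewrite hornerCM hornerX mulrC -[t in LHS]mulr1 -[t * 1]/(t *: (1 : K^o)) linearZ.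
- by exists (p + q) => t; rewrite hornerD hp hq.
- by exists (p * q) => t; rewrite hornerM hp hq.
Qed.

(** The linear part D depends on p alone, which is why tangent vectors at p form
    a subspace; the quadratic term of the parabola does not enter it, which is
    why parabolas may be used to exhibit tangent vectors. *)
Lemma polyfun_taylor W (g : W -> K) (p : W) : polyfun g ->
  exists D : 'Hom(W, K^o), forall v r : W, exists q : {poly K},
    forall t : K, g (p + t *: v + t ^+ 2 *: r) = g p + t * D v + t ^+ 2 * q.[t].
Proof.
elim=> [c|l|g1 g2 _ [D1 h1] _ [D2 h2]|g1 g2 _ [D1 h1] _ [D2 h2]].
- by exists 0 => v r; exists 0 => t; rewrite lfunE /= horner0 !mulr0 !addr0.
- exists l => v r; exists (l r)%:P => t.
  by rewrite hornerC !linearD !linearZ.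
- exists (D1 + D2) => v r; have [q1 hq1] := h1 v r; have [q2 hq2] := h2 v r.
  exists (q1 + q2) => t; rewrite hq1 hq2 hornerD.
  have -> : (D1 + D2) v = (D1 v : K) + (D2 v : K) by rewrite add_lfunE.
  by move: (D1 v : K) (D2 v : K) => a b /=; ring.
- exists (g2 p *: D1 + g1 p *: D2) => v r.
  have [q1 hq1] := h1 v r; have [q2 hq2] := h2 v r.
  exists ((D1 v * D2 v : K)%:P + g1 p *: q2 + g2 p *: q1
    + 'X * ((D1 v : K) *: q2 + (D2 v : K) *: q1) + 'X ^+ 2 * (q1 * q2)) => t.
  have -> : (g2 p *: D1 + g1 p *: D2) v = g2 p * (D1 v : K) + g1 p * (D2 v : K).
    by rewrite add_lfunE !scale_lfunE.
  rewrite hq1 hq2 !hornerE.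
  by move: (D1 v : K) (D2 v : K) => a b /=; ring.
Qed.

End PolynomialFunctions.

(** * Zariski tangent spaces *)

Section Tangent.
Variables (K : numFieldType) (W : vectType K).
Implicit Types (X : set W) (p v : W).

Lemma poly_eq0_fun (p : {poly K}) : (forall t, p.[t] = 0) -> p = 0.
Proof.
move=> h0; apply/eqP; apply: contraT => pn0.
have := @max_poly_roots _ p [seq n%:R | n <- iota 0 (size p)] pn0.
rewrite size_map size_iota ltnn; apply.
  by apply/allP => x _; apply/rootP.
rewrite map_inj_uniq ?iota_uniq //; exact: mulrIn (oner_neq0 K).
Qed.

Lemma horner_order2 (a b : K) (q : {poly K}) :
  (forall t, a + t * b = t ^+ 2 * q.[t]) -> b = 0.
Proof.
move=> h; have : a%:P + 'X * b%:P - 'X^2 * q = 0.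
  by apply: poly_eq0_fun => t; rewrite !hornerE h subrr.
move/(congr1 (fun p : {poly K} => p`_1)).
by rewrite coefB coefD coefC coefXM coefC coefXnM coef0 /= subr0 add0r.
Qed.

(** Parabolas are enough below: a frame moving linearly in t enters a matrix
    F s F^T quadratically. *)
Lemma tangent_curve X p v (r : W) :
  (forall t : K, X (p + t *: v + t ^+ 2 *: r)) -> tangent X p v.
Proof.
move=> hX g hg gX; have [D hD] := polyfun_taylor p hg.
have [q hq] := hD v r; have [q' hq'] := hD v 0.
exists (q' - q) => t; rewrite hornerD hornerN mulrBr.
have := hq t; rewrite gX // => /eqP; rewrite eq_sym addr_eq0 => /eqP h.
by have := hq' t; rewrite scaler0 addr0 h => ->; rewrite addrC.
Qed.

Lemma tangent_line X p v : (forall t : K, X (p + t *: v)) -> tangent X p v.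
Proof. by move=> h; apply: (@tangent_curve _ _ _ 0) => t; rewrite scaler0 addr0. Qed.

Lemma tangent_linear X p (a : K) u v : X p ->
  tangent X p u -> tangent X p v -> tangent X p (a *: u + v).
Proof.
move=> Xp hu hv g hg gX; have [D hD] := polyfun_taylor p hg.
have D0 w : tangent X p w -> D w = 0.
  move=> /(_ g hg gX)[q hq]; have [q' hq'] := hD w 0.
  apply: (@horner_order2 0 _ (q - q')) => t; rewrite add0r hornerD hornerN mulrBr.
  by rewrite -hq; have := hq' t; rewrite scaler0 addr0 (gX p Xp) add0r => ->; rewrite addrK.
have [q hq] := hD (a *: u + v) 0; exists q => t.
have := hq t; rewrite scaler0 addr0 => ->.
by rewrite linearP /= (D0 u hu) (D0 v hv) scaler0 addr0 (gX p Xp) mulr0 !add0r.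
Qed.

Lemma tangent0 X p : X p -> tangent X p 0.
Proof. by move=> Xp; apply: tangent_line => t; rewrite scaler0 addr0. Qed.

Lemma tangentZ X p (a : K) v : X p -> tangent X p v -> tangent X p (a *: v).
Proof.
by move=> Xp hv; rewrite -[_ *: v]addr0; apply: tangent_linear => //; apply: tangent0.
Qed.

Lemma tangentD X p u v : X p ->
  tangent X p u -> tangent X p v -> tangent X p (u + v).
Proof. by move=> Xp hu hv; rewrite -[u]scale1r; apply: tangent_linear. Qed.

Lemma tangent_eq0 X p v g (a b : K) : polyfun g -> (forall x, X x -> g x = 0) ->
  (forall t : K, g (p + t *: v) = t * a + t ^+ 2 * b) ->
  tangent X p v -> a = 0.
Proof.
move=> hg gX h /(_ g hg gX)[q hq].
apply: (@horner_order2 0 _ (q - b%:P)) => t.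
by rewrite add0r hornerD hornerN hornerC mulrBr -hq h addrK.
Qed.

(** Take a subspace of maximal dimension among those contained in P. *)
Lemma vspace_of_closed (P : W -> Prop) : P 0 ->
  (forall (a : K) u v, P u -> P v -> P (a *: u + v)) ->
  exists T : {vspace W}, forall v, v \in T <-> P v.
Proof.
move=> P0 Plin.
pose Q n := `[< exists T : {vspace W}, \dim T = n /\ forall v, v \in T -> P v >].
have exQ : exists n, Q n.
  exists 0%N; apply/asboolP; exists 0%VS; split; first exact: dimv0.
  by move=> v; rewrite memv0 => /eqP ->.
have ubQ n : Q n -> (n <= \dim {:W})%N.
  by move=> /asboolP[T [<- _]]; apply/dimvS/subvf.
case: (ex_maxnP exQ ubQ) => m /asboolP[T [dT TP]] maxm.
exists T => v; split; first exact: TP.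
move=> Pv; apply: contraT => vT.
have /maxm : Q (\dim (<[v]> + T)%VS).
  apply/asboolP; exists (<[v]> + T)%VS; split=> // w.
  by move=> /memv_addP[x /vlineP[k ->] [y yT ->]]; apply: Plin => //; apply: TP.
rewrite dimv_disjoint_sum ?dT.
  rewrite dim_vline; case: eqP vT => [->|]; first by rewrite mem0v.
  by rewrite add1n ltnn.
apply/eqP; rewrite -subv0; apply/subvP => w /memv_capP[/vlineP[k ->]].
case: (eqVneq k 0) => [->|kn0]; first by rewrite scale0r !mem0v.
by move=> kv; case/negP: vT; have := rpredZ k^-1 kv; rewrite scalerA mulVf // scale1r.
Qed.

Lemma tangent_space_exists X p : X p -> exists T, is_tangent_space X p T.
Proof.
move=> Xp; apply: vspace_of_closed => [|a u v]; first exact: tangent0.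
exact: tangent_linear.
Qed.

Lemma dim_inj_le (D : vectType K) (f : D -> W) (T : {vspace W}) :
  (forall (a : K) x y, f (a *: x + y) = a *: f x + f y) ->
  (forall u, f u = 0 -> u = 0) -> (forall u, f u \in T) ->
  (\dim {:D} <= \dim T)%N.
Proof.
move=> lin inj fT.
pose F : {linear D -> W} := HB.pack f (GRing.isLinear.Build K D W *:%R f lin).
have <- : \dim (linfun F @: fullv)%VS = \dim {:D}.
  apply: limg_dim_eq; apply/eqP; rewrite -subv0; apply/subvP => u.
  by rewrite memv_cap memv_ker lfunE memv0 => /andP[_ /eqP/inj ->].
by apply/dimvS/subvP => w /memv_imgP[u _ ->]; rewrite (lfunE F).
Qed.

Lemma dim_surj_ge (D : vectType K) (f : D -> W) (T : {vspace W}) :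
  (forall (a : K) x y, f (a *: x + y) = a *: f x + f y) ->
  (forall w, w \in T -> exists u, w = f u) ->
  (\dim T <= \dim {:D})%N.
Proof.
move=> lin surj.
pose F : {linear D -> W} := HB.pack f (GRing.isLinear.Build K D W *:%R f lin).
apply: leq_trans (_ : \dim (linfun F @: fullv)%VS <= _)%N.
  apply/dimvS/subvP => w /surj[u ->]; apply/memv_imgP.
  by exists u; rewrite ?memvf // lfunE.
by rewrite -(limg_ker_dim (linfun F) fullv) leq_addl.
Qed.

End Tangent.

(** * Morphisms given by local polynomial lifts *)

Section LocalLifts.
Variables (K : fieldType) (W W' : vectType K) (A A' : Type).
Variables (pi : W -> A) (pi' : W' -> A') (X : set A) (X' : set A').

(** A local section of W' -> A' over phi, given by polynomials, turns local
    equations and local fractions upstairs on the target into such data on the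
    source; the function h restricts to the open set on which the lift is
    valid. *)
Lemma local_lift_morphism
    (phi : coordinate_space pi X -> coordinate_space pi' X') :
  (forall (x : X) (w : W), pi w = val x ->
     exists (Phi : W -> W') (h : W -> K), [/\ polymap Phi, polyfun h, h w != 0 &
       forall (x' : X) (w' : W), pi w' = val x' -> h w' != 0 ->
         pi' (Phi w') = val (phi x' : X')]) ->
  is_morphism phi.
Proof.
move=> lift; split=> [O Oo x w /= Ox wx|O g Oo greg x w /= Ox wx].
  have [Phi [h [PhiP hP hw lifth]]] := lift x w wx.
  have [k [kP kw kO]] := Oo (phi x) (Phi w) Ox (lifth x w wx hw).
  exists (fun w => h w * k (Phi w)); split.
  - by apply: polyfun_mul => //; apply: (polyfun_comp PhiP kP).
  - by rewrite mulf_neq0.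
  - move=> x' w' wx'; rewrite mulf_eq0 negb_or => /andP[hw' kw'].
    exact: (kO (phi x') (Phi w') (lifth x' w' wx' hw') kw').
have [Phi [h [PhiP hP hw lifth]]] := lift x w wx.
have [a [b [aP bP bw gab]]] := greg (phi x) (Phi w) Ox (lifth x w wx hw).
exists (fun w => h w * a (Phi w)), (fun w => h w * b (Phi w)); split.
- by apply: polyfun_mul => //; apply: (polyfun_comp PhiP aP).
- by apply: polyfun_mul => //; apply: (polyfun_comp PhiP bP).
- by rewrite mulf_neq0.
- move=> x' w' Ox' wx'; rewrite mulf_eq0 negb_or => /andP[hw' bw'].
  rewrite (gab (phi x') (Phi w') Ox' (lifth x' w' wx' hw') bw').
  by rewrite -mulf_div divff // mul1r.
Qed.

End LocalLifts.

(** * Matrix coordinates *)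

Section Coordinates.
Variables (K : fieldType) (V : vectType K) (n : nat) (e : n.-tuple V).
Hypothesis he : basis_of {:V} e.

Definition cvec (v : V) : 'cV[K]_n := \col_i coord e i v.
Definition vecc (c : 'cV[K]_n) : V := \sum_i c i 0 *: e`_i.

Lemma veccK : cancel vecc cvec.
Proof.
by move=> c; apply/matrixP => i j; rewrite mxE coord_sum_free ?(basis_free he) // ord1.
Qed.

Lemma cvecK : cancel cvec vecc.
Proof.
move=> v; rewrite [RHS](coord_basis he) ?memvf //.
by apply: eq_bigr => i _; rewrite mxE.
Qed.

Lemma cvec_linear (a : K) u v : cvec (a *: u + v) = a *: cvec u + cvec v.
Proof. by apply/matrixP => i j; rewrite !mxE linearP. Qed.

Lemma vecc_linear (a : K) c d : vecc (a *: c + d) = a *: vecc c + vecc d.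
Proof.
by apply: (can_inj cvecK); rewrite cvec_linear !veccK.
Qed.

Lemma cvec_inj : injective cvec. Proof. exact: can_inj cvecK. Qed.

Lemma cvec0 : cvec 0 = 0.
Proof. by apply/matrixP => i j; rewrite !mxE linear0. Qed.

Definition lmx (M : 'M[K]_n) (v : V) : V := vecc (M *m cvec v).

Lemma lmx_linear M (a : K) u v : lmx M (a *: u + v) = a *: lmx M u + lmx M v.
Proof. by rewrite /lmx cvec_linear mulmxDr -scalemxAr vecc_linear. Qed.

HB.instance Definition _ M :=
  GRing.isLinear.Build K V V *:%R (lmx M) (lmx_linear M).

Definition endo_of_mx (M : 'M[K]_n) : 'End(V) := linfun (lmx M).

Local Notation mxe := (matrix_in_basis e).

Lemma cvec_basis (j : 'I_n) : cvec e`_j = delta_mx j 0.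
Proof.
by apply/matrixP => i k; rewrite !mxE coord_free ?(basis_free he) // ord1 eqxx andbT eq_sym.
Qed.

Lemma cvec_lfun (B : 'End(V)) v : cvec (B v) = mxe B *m cvec v.
Proof.
rewrite {1}[v](coord_basis he) ?memvf // linear_sum.
apply/matrixP => i k; rewrite !mxE linear_sum; apply: eq_bigr => j _.
by rewrite !mxE linearZ linearZ /= mulrC.
Qed.

Lemma cvec_endo M v : cvec (endo_of_mx M v) = M *m cvec v.
Proof. by rewrite lfunE /= veccK. Qed.

Lemma endo_of_mxK : cancel endo_of_mx mxe.
Proof.
move=> M; apply/matrixP => i j.
have := cvec_endo M e`_j; rewrite cvec_basis -colE => /matrixP/(_ i 0).
by rewrite !mxE.
Qed.

Lemma mxeK : cancel mxe endo_of_mx.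
Proof.
by move=> B; apply/lfunP => v; apply: cvec_inj; rewrite cvec_endo cvec_lfun.
Qed.

Lemma endo_of_mx_linear (a : K) M N :
  endo_of_mx (a *: M + N) = a *: endo_of_mx M + endo_of_mx N.
Proof.
apply/lfunP => v; apply: cvec_inj.
by rewrite cvec_endo add_lfunE scale_lfunE cvec_linear !cvec_endo mulmxDl scalemxAl.
Qed.

Lemma mxe_linear (a : K) B C : mxe (a *: B + C) = a *: mxe B + mxe C.
Proof. by apply: (can_inj endo_of_mxK); rewrite endo_of_mx_linear !mxeK. Qed.

Lemma mxe_comp (B C : 'End(V)) : mxe (B \o C)%VF = mxe B *m mxe C.
Proof.
apply: (can_inj endo_of_mxK); rewrite mxeK; apply/lfunP => v; apply: cvec_inj.
by rewrite cvec_endo lfunE /= !cvec_lfun mulmxA.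
Qed.

Lemma mxe0 : mxe 0 = 0.
Proof. by apply/matrixP => i j; rewrite !mxE lfunE /= linear0. Qed.

Lemma polymx_mxe : polymx mxe.
Proof.
move=> i j; apply: polyfun_linear => a B C.
by rewrite mxe_linear !mxE.
Qed.

Lemma polymap_endo (W : vectType K) (A : W -> 'M[K]_n) :
  polymx A -> polymap (fun x => endo_of_mx (A x)).
Proof.
move=> hA; apply: (@polymap_sum _ _ _ _ (fun ij x => A x ij.1 ij.2)
  (fun ij => endo_of_mx (delta_mx ij.1 ij.2))) => [x|ij]; last exact: hA.
rewrite [A x in LHS]matrix_sum_delta pair_big /=.
have endoD M N : endo_of_mx (M + N) = endo_of_mx M + endo_of_mx N.
  by rewrite -[M in LHS]scale1r endo_of_mx_linear scale1r.
have endo0 : endo_of_mx 0 = 0.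
  by apply: (can_inj mxeK); rewrite endo_of_mxK mxe0.
rewrite (big_morph _ endoD endo0); apply: eq_bigr => ij _.
by rewrite -[X in endo_of_mx X]addr0 endo_of_mx_linear endo0 addr0.
Qed.

Lemma polymap_vecc (W : vectType K) (A : W -> 'cV[K]_n) :
  polymx A -> polymap (fun x => vecc (A x)).
Proof.
move=> hA; apply: (@polymap_sum _ _ _ _ (fun i x => A x i 0) (fun i => e`_i)) => //.
Qed.

Definition coordmx k (X : seq V) : 'M[K]_(n, k) := \matrix_(i, j) coord e i X`_j.

Lemma coordmx_row_free k (X : k.-tuple V) : free X -> row_free (coordmx k X)^T.
Proof.
move=> /freeP freeX; apply: inj_row_free => c hc; apply/rowP => j; rewrite mxE.
apply: (freeX (fun j => c 0 j)); apply: cvec_inj; rewrite cvec0.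
rewrite -[RHS]trmx0 -hc; apply/matrixP => i j'.
rewrite trmx_mul !mxE linear_sum; apply: eq_bigr => l _.
by rewrite !mxE linearZ /= mulrC ord1.
Qed.

Definition framemx (u : V * V) : 'M[K]_(n, 2) := coordmx 2 [:: u.1; u.2].

Lemma framemx_left_inverse u :
  free [:: u.1; u.2] -> exists L, L *m framemx u = 1%:M.
Proof.
move=> /(@coordmx_row_free 2 [tuple u.1; u.2])/row_freeP[L hL].
by exists L^T; apply: trmx_inj; rewrite trmx_mul trmxK hL trmx1.
Qed.

Definition frame_of_mx (F : 'M[K]_(n, 2)) : V * V :=
  (vecc (col 0 F), vecc (col 1 F)).

Lemma frame_of_mxK : cancel frame_of_mx framemx.
Proof.
move=> F; apply/matrixP => i k; rewrite mxE.
have coordvecc c : coord e i (vecc c) = c i 0.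
  by have /matrixP/(_ i 0) := veccK c; rewrite mxE.
by case: k => -[|[|//]] hk /=; rewrite coordvecc mxE; congr (F _ _); apply: val_inj.
Qed.

Lemma framemxK : cancel framemx frame_of_mx.
Proof.
case=> u v; rewrite /frame_of_mx.
by congr (_, _); apply: cvec_inj; rewrite veccK; apply/matrixP=> i j; rewrite !mxE.
Qed.

Lemma mul_framemx (B : 'End(V)) u :
  mxe B *m framemx u = framemx (B u.1, B u.2).
Proof. apply/matrixP => i k; rewrite [RHS]mxE.
have hc w : coord e i (B w) = (mxe B *m cvec w) i 0 by rewrite -cvec_lfun mxE.
by case: k => -[|[|//]] hk /=; rewrite hc !mxE; apply: eq_bigr => j _; rewrite !mxE. Qed.

Lemma framemx_mul u (N : 'M[K]_2) :
  frame_of_mx (framemx u *m N) =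
    (N 0 0 *: u.1 + N 1 0 *: u.2, N 0 1 *: u.1 + N 1 1 *: u.2).
Proof.
apply: (can_inj framemxK); rewrite frame_of_mxK; apply/matrixP => i k.
rewrite !mxE !big_ord_recl big_ord0 addr0 !mxE /=.
have N_ i1 j1 i2 j2 : val i1 = val i2 -> val j1 = val j2 -> N i1 j1 = N i2 j2.
  by move=> /val_inj -> /val_inj ->.
case: k => -[|[|//]] hk /=; rewrite linearD !linearZ /=;
  by rewrite ![_ * N _ _]mulrC; congr (_ * _ + _ * _); apply: N_.
Qed.

End Coordinates.

(** * Symmetric matrices and the symplectic Lie algebra *)

Section SymplecticCoordinates.
Variables (K : numFieldType) (V : vectType K) (omega : {skew_symmetric V}).
Variables (n : nat) (e : n.-tuple V).
Hypothesis he : basis_of {:V} e.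
Hypothesis homega : nondegenerate omega.

Local Notation mxe := (matrix_in_basis e).

Definition gram : 'M[K]_n := \matrix_(i, j) omega e`_i e`_j.
Local Notation J := gram.

Lemma omegaC u v : omega u v = - omega v u.
Proof. by rewrite hermC /= expr1 mulN1r. Qed.

Lemma omega_alt u : omega u u = 0.
Proof.
have /eqP := omegaC u u; rewrite -addr_eq0 -mulr2n -mulr_natl mulf_eq0.
by rewrite pnatr_eq0 /= => /eqP.
Qed.

Lemma omegaE u v : omega u v = ((cvec e u)^T *m J *m cvec e v) 0 0.
Proof.
rewrite {1}[u](coord_basis he) ?memvf // linear_sumlz /= mxE.
under eq_bigr => i _ do rewrite {1}[v](coord_basis he) ?memvf // linear_sumr.
rewrite exchange_big /=; apply: eq_bigr => j _.
rewrite mxE big_distrl /=; apply: eq_bigr => i _.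
by rewrite !mxE linearZlr /= -mulrA; congr (_ * _); rewrite mulrC.
Qed.

Lemma gram_skew : J^T = - J.
Proof. by apply/matrixP => i j; rewrite !mxE omegaC. Qed.

Lemma omega_nondeg u : (forall v, omega u v = 0) -> u = 0.
Proof.
move=> hu; apply/eqP; rewrite -memv0 -(eqP homega).
by apply/mem_orthovP => v _; apply: hu.
Qed.

Lemma gram_unit : J \in unitmx.
Proof.
rewrite -row_free_unit -kermx_eq0; apply/eqP/row_matrixP => i; rewrite row0.
set r := row i _.
have rJ : r *m J = 0 by apply/sub_kermxP/row_sub.
have /omega_nondeg r0 : forall v, omega (vecc e r^T) v = 0.
  by move=> v; rewrite omegaE veccK // trmxK rJ mul0mx mxE.
by apply: trmx_inj; rewrite -(veccK he r^T) r0 cvec0 trmx0.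
Qed.

Lemma mxP_bilin (A : 'M[K]_n) :
  (forall u v, ((cvec e u)^T *m A *m cvec e v) 0 0 = 0) -> A = 0.
Proof.
move=> hA; apply/matrixP => i j; have := hA e`_i e`_j.
by rewrite !cvec_basis // trmx_delta -rowE -colE !mxE.
Qed.

Lemma sp_algE (B : 'End(V)) :
  sp_alg omega B <-> (mxe B)^T *m J + J *m mxe B = 0.
Proof.
have E u v : omega (B u) v + omega u (B v) =
    ((cvec e u)^T *m ((mxe B)^T *m J + J *m mxe B) *m cvec e v) 0 0.
  rewrite !omegaE !cvec_lfun // trmx_mul mulmxDr mulmxDl !mulmxA.
  by rewrite [RHS]mxE.
split=> [hB|hB u v]; first by apply: mxP_bilin => u v; rewrite -E hB.
by rewrite E hB mulmx0 mul0mx mxE.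
Qed.

(** With this twist by the Gram matrix the symplectic Lie algebra becomes the
    space of symmetric matrices, and x |-> omega(v, x) v becomes v v^T. *)
Definition isym (S : 'M[K]_n) : 'End(V) := endo_of_mx e (S *m J).
Definition symof (B : 'End(V)) : 'M[K]_n := mxe B *m invmx J.

Lemma isymK : cancel isym symof.
Proof. by move=> S; rewrite /symof endo_of_mxK // mulmxK // gram_unit. Qed.

Lemma symofK : cancel symof isym.
Proof. by move=> B; rewrite /isym mulmxKV ?gram_unit // mxeK. Qed.

Lemma mxe_symof B : mxe B = symof B *m J.
Proof. by rewrite mulmxKV ?gram_unit. Qed.

Lemma mxe_isym S : mxe (isym S) = S *m J.
Proof. by rewrite endo_of_mxK. Qed.

Lemma isym_linear (a : K) S T : isym (a *: S + T) = a *: isym S + isym T.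
Proof. by rewrite /isym mulmxDl -scalemxAl endo_of_mx_linear. Qed.

Lemma isymD S T : isym (S + T) = isym S + isym T.
Proof. by rewrite -[S in LHS]scale1r isym_linear scale1r. Qed.

Lemma isym0 : isym 0 = 0.
Proof. by apply: (can_inj symofK); rewrite isymK /symof mxe0 mul0mx. Qed.

Lemma isymZ (a : K) S : isym (a *: S) = a *: isym S.
Proof. by rewrite -[X in isym X]addr0 isym_linear isym0 addr0. Qed.

Lemma symof_linear (a : K) B C : symof (a *: B + C) = a *: symof B + symof C.
Proof. by apply: (can_inj isymK); rewrite isym_linear !symofK. Qed.

Lemma polymx_symof : polymx symof.
Proof. by apply: polymx_mul; [exact: polymx_mxe|exact: polymx_const]. Qed.

Lemma sp_isym S : sp_alg omega (isym S) <-> S^T = S.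
Proof.
rewrite sp_algE mxe_isym trmx_mul gram_skew !mulNmx mulmxA addrC.
rewrite -mulmxBl -mulmxBr; split=> [h|->]; last by rewrite subrr mulmx0 mul0mx.
apply/esym/eqP; rewrite -subr_eq0; apply/eqP.
apply: (can_inj (mulKmx gram_unit)); apply: (can_inj (mulmxK gram_unit)).
by rewrite h mulmx0 mul0mx.
Qed.

Lemma square_zero_isym S :
  square_zero omega (isym S) <-> S^T = S /\ S *m J *m S = 0.
Proof.
rewrite /square_zero /= sp_isym; split=> -[hS hSS]; split=> //.
  have := congr1 mxe hSS; rewrite mxe_comp // mxe_isym mxe0 mulmxA => h.
  by apply: (can_inj (mulmxK gram_unit)); rewrite h mul0mx.
apply: (can_inj (mxeK he)); rewrite mxe_comp // mxe_isym mxe0 mulmxA hSS.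
exact: mul0mx.
Qed.

Lemma coordmx_gram m (X : seq V) k l :
  ((coordmx e m X)^T *m J *m coordmx e m X) k l = omega X`_k X`_l.
Proof.
rewrite omegaE (_ : cvec e _ = col k (coordmx e m X)); last first.
  by apply/matrixP => i j; rewrite !mxE.
rewrite (_ : cvec e _ = col l (coordmx e m X)); last first.
  by apply/matrixP => i j; rewrite !mxE.
by rewrite tr_col -row_mul [col l _]colE mulmxA -row_mul -colE [RHS]mxE [RHS]mxE.
Qed.

Lemma isotropicP (U : {vspace V}) :
  isotropic omega U <-> {in U & U, forall u v, omega u v = 0}.
Proof. by rewrite /isotropic; split=> /orthovP. Qed.

(** The coordinate matrix F of a basis of U satisfies F^T J F = 0 with J
    invertible, and two factors with zero product have ranks adding up to at
    most n. *)
Lemma isotropic_dim (U : {vspace V}) :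
  isotropic omega U -> (\dim U + \dim U <= n)%N.
Proof.
move=> /isotropicP Uiso; set F := coordmx e (\dim U) (vbasis U).
have rF : \rank F = \dim U.
  rewrite -mxrank_tr; apply/eqP; apply: coordmx_row_free => //.
  exact: (basis_free (vbasisP U)).
have F0 : F^T *m J *m F = 0.
  apply/matrixP => i j; rewrite coordmx_gram mxE.
  by apply: Uiso; apply: vbasis_mem; apply: mem_nth; rewrite size_tuple.
have := mulmx0_rank_max F0; rewrite mxrankMfree ?row_free_unit ?gram_unit //.
by rewrite mxrank_tr rF.
Qed.

Lemma isotropic_add (U : {vspace V}) v :
  isotropic omega U -> v \in orthov omega U -> isotropic omega (<[v]> + U)%VS.
Proof.
move=> /isotropicP Uiso /mem_orthovP vU; apply/isotropicP => x y.
move=> /memv_addP[_ /vlineP[a ->] [x' x'U ->]].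
move=> /memv_addP[_ /vlineP[b ->] [y' y'U ->]].
rewrite linearDl !linearDr linearZlr linearZl_LR linearZr_LR /= omega_alt.
by rewrite (omegaC x') !vU // Uiso // oppr0 !mulr0 !addr0.
Qed.

Lemma isotropic_extend (U : {vspace V}) : isotropic omega U ->
  exists U' : {vspace V}, maximal_isotropic omega U' /\ (U <= U')%VS.
Proof.
move=> Uiso.
pose Q m := `[< exists T : {vspace V}, [/\ \dim T = m, isotropic omega T & (U <= T)%VS] >].
have exQ : exists m, Q m by exists (\dim U); apply/asboolP; exists U.
have ubQ m : Q m -> (m <= \dim {:V})%N.
  by move=> /asboolP[T [<- _ _]]; apply/dimvS/subvf.
case: (ex_maxnP exQ ubQ) => m /asboolP[T [dT Tiso UT]] maxm.
exists T; split=> //; split=> // T' T'iso TT'.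
apply/esym/eqP; rewrite eqEdim TT' dT; apply: maxm.
by apply/asboolP; exists T'; split=> //; apply: subv_trans TT'.
Qed.

End SymplecticCoordinates.

(** * Lagrangian planes *)

Section LagrangianPlanes.
Variables (K : numFieldType) (V : vectType K) (omega : {skew_symmetric V}).
Variable (e : 4.-tuple V).
Hypothesis he : basis_of {:V} e.
Hypothesis homega : nondegenerate omega.

Local Notation mxe := (matrix_in_basis e).
Local Notation J := (gram omega e).
Local Notation isym := (isym omega e).
Local Notation symof := (symof omega e).

Lemma isotropic_dim_le2 (U : {vspace V}) : isotropic omega U -> (\dim U <= 2)%N.
Proof.
move=> /(isotropic_dim he homega); rewrite addnn -muln2.
by rewrite (leq_mul2r 2 (\dim U) 2).
Qed.

(** A line has an orthogonal of dimension at least 3, so an isotropic subspace of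
    dimension at most one can be enlarged, the form being alternating. *)
Lemma dim_maximal_isotropic (U : {vspace V}) :
  maximal_isotropic omega U -> \dim U = 2%N.
Proof.
move=> [Uiso maxU]; apply/eqP; rewrite eqn_leq isotropic_dim_le2 //= ltnNge.
apply/negP => dU.
have [v vO vU] : exists2 v, v \in orthov omega U & v \notin U.
  apply/subvPn; apply/negP => /dimvS dO.
  have dimV : \dim {:V} = 4%N by rewrite (size_basis he).
  have : (3 <= \dim (orthov omega U))%N.
    have [x ->] : exists x, U = <[x]>%VS.
      have := span_basis (vbasisP U); move: (vbasis U) dU.
      case: (\dim U) => [|[|//]] [[|x [|]] //= _] _ <-.
        by exists 0; rewrite span_nil; apply/esym/eqP; rewrite -subv0 -memvE mem0v.
      by exists x; rewrite span_seq1.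
    by have := leq_dim_orthov1 omega x fullv; rewrite capfv dimV.
  by rewrite leqNgt (leq_ltn_trans dO) // ltnS (leq_trans dU).
have := maxU _ (isotropic_add Uiso vO) (addvSr _ _) => UE.
by case/negP: vU; rewrite -UE memvE addvSl.
Qed.

Lemma maximal_isotropic_frame (U : {vspace V}) : maximal_isotropic omega U ->
  exists u : V * V, free [:: u.1; u.2] /\ U = <<[:: u.1; u.2]>>%VS.
Proof.
move=> /dim_maximal_isotropic dU.
have := vbasisP U; have := size_tuple (vbasis U); rewrite {2}dU.
case: (tval _) => [|u [|v [|]]] //= _ bU.
by exists (u, v); rewrite (basis_free bU) -(span_basis bU).
Qed.
End LagrangianPlanes.

(** * Square-zero matrices in symplectic frames *)

Section SymplecticMatrices.
Variables (K : numFieldType) (J : 'M[K]_4).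
Hypotheses (Jskew : J^T = - J) (Junit : J \in unitmx).
Implicit Types (F G : 'M[K]_(4, 2)) (S H : 'M[K]_4) (s h k : 'M[K]_2).

Definition sqzero_sym S : Prop := S^T = S /\ S *m J *m S = 0.

Definition isotropic_frame F : Prop := F^T *m J *m F = 0.

Lemma sqzero_frame F s : isotropic_frame F -> s^T = s ->
  sqzero_sym (F *m s *m F^T).
Proof.
move=> F0 hs; split; first by rewrite !trmx_mul trmxK hs mulmxA.
by rewrite -!mulmxA (mulmxA F^T) (mulmxA (F^T *m J)) F0 !(mul0mx, mulmx0).
Qed.

Lemma tr_gram m p (A : 'M[K]_(4, m)) (B : 'M[K]_(4, p)) :
  (A^T *m J *m B)^T = - (B^T *m J *m A).
Proof. by rewrite !trmx_mul trmxK Jskew mulmxA mulmxN mulNmx. Qed.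

(** The columns of F and G form a symplectic basis.  A first G0, dual to F, is
    corrected by multiples of F to become isotropic; the last identity is the
    resolution of the identity in that basis, read as a product of two inverse
    block matrices in the other order. *)
Lemma symplectic_complement F L : isotropic_frame F -> L *m F = 1%:M ->
  exists G, [/\ F^T *m J *m G = 1%:M, G^T *m J *m G = 0 &
    G *m F^T *m J - F *m G^T *m J = 1%:M].
Proof.
move=> F0 LF; pose G0 := invmx J *m L^T.
have FG0 : F^T *m J *m G0 = 1%:M.
  by rewrite mulmxA mulmxK // -trmx_mul LF trmx1.
have G0F : G0^T *m J *m F = - 1%:M.
  by apply: trmx_inj; rewrite tr_gram FG0 raddfN /= trmx1.
pose b := 2^-1 *: (G0^T *m J *m G0).
have bT : b^T = - b by rewrite linearZ /= tr_gram scalerN.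
pose G := G0 + F *m b.
have FG : F^T *m J *m G = 1%:M.
  by rewrite mulmxDr FG0 (mulmxA _ F) F0 mul0mx addr0.
have GF : G^T *m J *m F = - 1%:M.
  by apply: trmx_inj; rewrite tr_gram FG raddfN /= trmx1.
have G0G : G0^T *m J *m G = b.
  rewrite {1}/G mulmxDr (mulmxA _ F) G0F mulNmx mul1mx.
  have -> : G0^T *m J *m G0 = b + b.
    by rewrite -mulr2n -scaler_nat scalerA divff ?pnatr_eq0 // scale1r.
  by rewrite addrK.
have GG : G^T *m J *m G = 0.
  rewrite {2}/G mulmxDr (mulmxA _ F) GF mulNmx mul1mx.
  have -> : G^T *m J *m G0 = b.
    by apply: trmx_inj; rewrite tr_gram G0G bT.
  by rewrite subrr.
exists G; split=> //.
have : col_mx (- (G^T *m J)) (F^T *m J) *m row_mx F G = 1%:M :> 'M_(2 + 2).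
  by rewrite mul_col_row !mulNmx FG GG GF F0 opprK oppr0 -scalar_mx_block.
move/mulmx1C; rewrite mul_row_col mulmxN addrC => <-.
by rewrite !mulmxA.
Qed.

Section Frame.
Variables (F G : 'M[K]_(4, 2)) (L : 'M[K]_(2, 4)).
Hypotheses (F0 : isotropic_frame F) (LF : L *m F = 1%:M)
  (FG : F^T *m J *m G = 1%:M) (GG : G^T *m J *m G = 0)
  (resol : G *m F^T *m J - F *m G^T *m J = 1%:M).

Lemma frame_GF : G^T *m J *m F = - 1%:M.
Proof. by apply: trmx_inj; rewrite tr_gram FG raddfN /= trmx1. Qed.

Lemma frame_FL : F^T *m L^T = 1%:M.
Proof. by rewrite -trmx_mul LF trmx1. Qed.

(** The condition F^T J S = 0 says that the image of S is orthogonal to the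
    Lagrangian plane of F, hence contained in it. *)
Lemma sym_of_image S : S^T = S -> F^T *m J *m S = 0 ->
  exists s, s^T = s /\ S = F *m s *m F^T.
Proof.
move=> hS FS; have SF : S = - (F *m G^T *m J *m S).
  by rewrite -{1}[S]mul1mx -resol mulmxBl -(mulmxA G) -(mulmxA G) FS mulmx0 sub0r.
have SF' : S = S *m J *m G *m F^T.
  rewrite -{1}hS {1}SF raddfN /= !trmx_mul trmxK Jskew hS.
  by rewrite mulNmx mulmxN opprK !mulmxA.
exists (- (G^T *m J *m S *m J *m G)); split.
  rewrite raddfN /= !trmx_mul trmxK Jskew hS !(mulNmx, mulmxN) opprK.
  by rewrite !mulmxA.
by rewrite {1}SF {1}SF' mulmxN mulNmx !mulmxA.
Qed.

(** Linearising S J S = 0 at S = F s F^T.  In the block decomposition of H along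
    (F, G) the G-G block vanishes, the F-F block is free, and the mixed block k'
    satisfies s k' = k'^T s, that is k' = k s with k symmetric: 3 + 3
    parameters, which are exactly those swept out by moving s and moving F to
    F + t G k. *)
Lemma anticommutant_param s H : s^T = s -> s \in unitmx -> H^T = H ->
  F *m s *m F^T *m J *m H + H *m J *m (F *m s *m F^T) = 0 ->
  exists h k, [/\ h^T = h, k^T = k &
    H = F *m h *m F^T + (G *m k *m s *m F^T + F *m s *m k *m G^T)].
Proof.
move=> hs us hH anti.
have canFs m (A : 'M_(m, 2)) : A *m s *m F^T = 0 -> A = 0.
  move=> A0; apply: (can_inj (mulmxK us)).
  by rewrite -[A *m s]mulmx1 -frame_FL mulmxA A0 !mul0mx.
have HFF : F^T *m J *m H *m J *m F = 0.
  apply: canFs; have := congr1 (fun A => F^T *m J *m A) anti.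
  by rewrite mulmx0 mulmxDr !mulmxA (F0 : _ *m F = 0) !mul0mx add0r.
pose k := F^T *m J *m H *m J *m G.
have kT : k^T = G^T *m J *m H *m J *m F.
  rewrite /k !trmx_mul trmxK Jskew hH.
  by rewrite !(mulNmx, mulmxN) opprK !mulmxA.
have sk : s *m k = k^T *m s.
  have := congr1 (fun A => G^T *m J *m A *m J *m G) anti.
  rewrite mulmx0 !mul0mx mulmxDr !mulmxDl !mulmxA frame_GF !mulNmx mul1mx.
  rewrite -[_ *m F^T *m J *m G]mulmxA -[_ *m F^T *m (J *m G)]mulmxA.
  rewrite (mulmxA F^T) FG mulmx1 -kT => /eqP; rewrite addrC subr_eq0 => /eqP ->.
  by [].
exists (- (G^T *m J *m H *m J *m G)), (k *m invmx s); split.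
- rewrite raddfN /= !trmx_mul trmxK Jskew hH.
  by rewrite !(mulNmx, mulmxN) opprK !mulmxA.
- rewrite trmx_mul trmx_inv hs; apply: (can_inj (mulmxK us)); rewrite mulmxKV //.
  by rewrite -mulmxA -sk mulKmx.
have resolT : J *m G *m F^T - J *m F *m G^T = 1%:M.
  rewrite -[RHS]trmx1 -resol raddfB /= !trmx_mul !trmxK Jskew.
  by rewrite !mulNmx opprK addrC !mulmxA.
have ks : F *m s *m (k *m invmx s) = F *m k^T.
  by rewrite -mulmxA (mulmxA s) sk mulmxK.
rewrite (mulmxA G) mulmxKV // ks.
have HE : H = (G *m F^T *m J - F *m G^T *m J) *m H *m
    (J *m G *m F^T - J *m F *m G^T) by rewrite resol resolT mul1mx mulmx1.
have GFF : G *m F^T *m J *m H *m J *m F = 0.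
  by have := congr1 (mulmx G) HFF; rewrite mulmx0 !mulmxA.
rewrite {1}HE mulmxBl mulmxBr !mulmxBl !mulmxA GFF mul0mx sub0r opprK.
by rewrite kT mulmxN mulNmx !mulmxA [X in X + _]addrC addrA.
Qed.

Lemma moving_frame_isotropic k (t : K) : k^T = k ->
  isotropic_frame (F + t *: (G *m k)).
Proof.
move=> hk; have Gk : (G *m k)^T *m J *m (G *m k) = 0.
  by rewrite trmx_mul hk -!mulmxA !(mulmxA G^T) (mulmxA (G^T *m J)) GG mul0mx mulmx0.
have FGk : F^T *m J *m (G *m k) = k by rewrite mulmxA FG mul1mx.
have GkF : (G *m k)^T *m J *m F = - k.
  by apply: trmx_inj; rewrite tr_gram FGk raddfN /= hk.
rewrite /isotropic_frame [_^T]raddfD /= linearZ /= !mulmxDl !mulmxDr.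
rewrite -!scalemxAl -!scalemxAr FGk GkF Gk (F0 : F^T *m J *m F = 0).
by rewrite !scaler0 add0r addr0 scalerN subrr.
Qed.

Lemma moving_frame_expand s k (t : K) : k^T = k ->
  (F + t *: (G *m k)) *m s *m (F + t *: (G *m k))^T =
  F *m s *m F^T + t *: (G *m k *m s *m F^T + F *m s *m k *m G^T)
    + t ^+ 2 *: (G *m k *m s *m k *m G^T).
Proof.
move=> hk; rewrite [_^T]raddfD /= linearZ /= trmx_mul hk !mulmxDl !mulmxDr.
rewrite -!scalemxAl -!scalemxAr scalerA -expr2 !mulmxA scalerDr !addrA.
by congr (_ + _); rewrite -!addrA; congr (_ + _); rewrite addrC.
Qed.

Lemma frame_param_inj s h k : s \in unitmx ->
  F *m h *m F^T + (G *m k *m s *m F^T + F *m s *m k *m G^T) = 0 ->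
  h = 0 /\ k = 0.
Proof.
move=> us E0.
have canF m (A : 'M_(m, 2)) : A *m F^T = 0 -> A = 0.
  by move=> A0; rewrite -[A]mulmx1 -frame_FL mulmxA A0 mul0mx.
have k0 : k = 0.
  have := congr1 (fun A => F^T *m J *m A) E0.
  rewrite mulmx0 !mulmxDr !mulmxA (F0 : _ *m F = 0) FG !mul0mx add0r addr0 mul1mx.
  by move/canF => ks; apply: (can_inj (mulmxK us)); rewrite ks mul0mx.
split=> //; move: E0; rewrite k0 !(mulmx0, mul0mx) !addr0 => /canF Fh.
by rewrite -[h]mul1mx -LF -mulmxA Fh mulmx0.
Qed.

End Frame.

Definition pairing (x y : 'cV[K]_4) : K := (x^T *m J *m y) 0 0.

Lemma outer_mul (x y z : 'cV[K]_4) : x *m y^T *m J *m z = pairing y z *: x.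
Proof.
rewrite -!mulmxA [y^T *m _]mx11_scalar -mul_mx_scalar !mulmxA; congr (x *m _).
Qed.

Lemma pairingC x y : pairing x y = - pairing y x.
Proof.
by have /matrixP/(_ 0 0) := tr_gram y x; rewrite /pairing mxE => ->; rewrite [in RHS]mxE opprK.
Qed.

Lemma frame_pairing (F G : 'M[K]_(4, 2)) i j :
  pairing (col i F) (col j G) = (F^T *m J *m G) i j.
Proof.
rewrite /pairing tr_col -row_mul [col j _]colE mulmxA -row_mul -colE.
by rewrite [LHS]mxE mxE.
Qed.

(** Coordinates on the symmetric 2x2 matrices: the entry (i, j) is the coordinate
    of index i + j. *)
Definition sym2 (c : 'rV[K]_3) : 'M[K]_2 := \matrix_(i, j) c 0 (inord (i + j)).

Lemma sym2_tr c : (sym2 c)^T = sym2 c.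
Proof. by apply/matrixP => i j; rewrite !mxE addnC. Qed.

Lemma sym2_linear (a : K) c d : sym2 (a *: c + d) = a *: sym2 c + sym2 d.
Proof. by apply/matrixP => i j; rewrite !mxE. Qed.

Lemma sym2_inj c : sym2 c = 0 -> c = 0.
Proof.
move=> /matrixP c0; apply/rowP => k; rewrite mxE.
have E (i j : 'I_2) : c 0 (inord (i + j)) = 0 by have := c0 i j; rewrite !mxE.
case: k => -[|[|[|//]]] hk.
- by rewrite -(E 0 0); congr (c 0 _); apply: val_inj; rewrite /= inordK.
- by rewrite -(E 0 1); congr (c 0 _); apply: val_inj; rewrite /= inordK.
- by rewrite -(E 1 1); congr (c 0 _); apply: val_inj; rewrite /= inordK.
Qed.

Lemma sym2_surj s : s^T = s -> exists c, s = sym2 c.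
Proof.
move=> hs; have h10 : s 1 0 = s 0 1 by rewrite -{1}hs mxE.
exists (\row_k [:: s 0 0; s 0 1; s 1 1]`_k).
have s_ i j i' j' : val i = val i' -> val j = val j' -> s i j = s i' j'.
  by move=> /val_inj -> /val_inj ->.
apply/matrixP => i j; rewrite !mxE.
case: i => -[|[|//]] hi; case: j => -[|[|//]] hj; rewrite inordK //=.
- exact: s_.
- exact: s_.
- by rewrite -h10; apply: s_.
- exact: s_.
Qed.

Lemma pairing_alt x : pairing x x = 0.
Proof.
have /eqP := pairingC x x.
by rewrite -addr_eq0 -mulr2n mulrn_eq0 => /eqP.
Qed.

Lemma sqzero_outer2 (x y : 'cV[K]_4) (s t : K) : pairing x y = 0 ->
  sqzero_sym (s *: (x *m x^T) + t *: (y *m y^T)).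
Proof.
move=> xy; have yx : pairing y x = 0 by rewrite pairingC xy oppr0.
split; first by rewrite linearD !linearZ /= !trmx_mul !trmxK.
rewrite mulmxDr !mulmxDl -!scalemxAr -!scalemxAl !mulmxA !outer_mul.
by rewrite !pairing_alt xy yx !(scale0r, mul0mx, scaler0, addr0).
Qed.

Section SingularPoint.
Variables (a b g1 g2 : 'cV[K]_4).
Hypotheses (aa : pairing a a = 0) (ab : pairing a b = 0)
  (ag1 : pairing a g1 = 1) (ag2 : pairing a g2 = 0) (bb : pairing b b = 0)
  (bg1 : pairing b g1 = 0) (bg2 : pairing b g2 = 1) (g12 : pairing g1 g2 = 0)
  (g22 : pairing g2 g2 = 0).

(** At the point a a^T the tangent space contains a w^T + w a^T for all w and the
    squares of vectors orthogonal to a.  Modulo a, the latter are spanned by b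
    and g2, so that 4 + 3 parameters remain, where (a, b, g1, g2) is a symplectic
    basis. *)
Definition singular_dir (x : 'cV[K]_4 * 'rV[K]_3) : 'M[K]_4 :=
  (a *m x.1^T + x.1 *m a^T) +
  (x.2 0 0 *: (b *m b^T) + x.2 0 1 *: (b *m g2^T + g2 *m b^T)
    + x.2 0 2 *: (g2 *m g2^T)).

Lemma singular_dir_inj x : singular_dir x = 0 -> x = 0.
Proof.
case: x => w c; rewrite /singular_dir /=.
set N := _ *: _ + _ + _ => E0.
(* Contracting with vectors of the symplectic basis isolates the coefficients. *)
have mulz z : pairing w z *: a + pairing a z *: w +
   (c 0 0 * pairing b z) *: b + (c 0 1 * pairing g2 z) *: b +
   (c 0 1 * pairing b z) *: g2 + (c 0 2 * pairing g2 z) *: g2 = 0.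
  have := congr1 (fun A => A *m J *m z) E0; rewrite !mul0mx /N.
  rewrite !mulmxDl -!scalemxAl !mulmxDl !outer_mul scalerDr !scalerA !addrA.
  by move=> <-.
have pairZ t x z : pairing (t *: x) z = t * pairing x z.
  by rewrite /pairing linearZ /= -!scalemxAl mxE.
have pairD x y z : pairing (x + y) z = pairing x z + pairing y z.
  by rewrite /pairing raddfD /= !mulmxDl mxE.
have pair0 z : pairing 0 z = 0 by rewrite /pairing trmx0 !mul0mx mxE.
have g21 : pairing g2 g1 = 0 by rewrite pairingC g12 oppr0.
have g2b : pairing g2 b = -1 by rewrite pairingC bg2.
have w0 : w = 0.
  have := mulz g1; rewrite ag1 bg1 g21 !mulr0 !scale0r !addr0 scale1r => Ew.
  have := congr1 (fun x => pairing x g1) Ew.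
  rewrite pairD pairZ ag1 mulr1 pair0 -mulr2n => /eqP.
  rewrite mulrn_eq0 /= => /eqP m0.
  by move: Ew; rewrite m0 scale0r add0r.
have Eg := mulz g2; rewrite w0 pair0 ag2 bg2 g22 !mulr0 !mulr1 !scale0r in Eg.
rewrite ?scaler0 !addr0 !add0r in Eg.
have Eb := mulz b; rewrite w0 pair0 ab bb g2b !mulr0 !mulrN1 !scale0r in Eb.
rewrite ?scaler0 !addr0 !add0r in Eb.
have c00 : c 0 0 = 0.
  have := congr1 (fun x => pairing x g2) Eg.
  by rewrite pairD !pairZ bg2 g22 pair0 mulr1 mulr0 addr0.
have c01 : c 0 1 = 0.
  have := congr1 (fun x => pairing x b) Eg.
  rewrite pairD !pairZ bb g2b pair0 mulr0 add0r mulrN1 => /eqP.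
  by rewrite oppr_eq0 => /eqP.
have c02 : c 0 2 = 0.
  have := congr1 (fun x => pairing x b) Eb.
  by rewrite pairD !pairZ bb g2b pair0 mulr0 add0r mulrN1 opprK.
rewrite w0; congr (_, _); apply/rowP => k; rewrite mxE.
case: k => -[|[|[|//]]] hk.
- by rewrite -c00; congr (c 0 _); apply: val_inj.
- by rewrite -c01; congr (c 0 _); apply: val_inj.
- by rewrite -c02; congr (c 0 _); apply: val_inj.
Qed.

Lemma singular_dir_linear (t : K) x y :
  singular_dir (t *: x + y) = t *: singular_dir x + singular_dir y.
Proof.
by apply/matrixP => i j; rewrite !(mxE, big_ord1) /=; ring.
Qed.

End SingularPoint.
End SymplecticMatrices.

(** * The singular locus *)

Section SingularLocus.
Variables (K : numFieldType) (V : vectType K) (omega : {skew_symmetric V}).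
Variable (e : 4.-tuple V).
Hypothesis he : basis_of {:V} e.
Hypothesis homega : nondegenerate omega.

Local Notation mxe := (matrix_in_basis e).
Local Notation J := (gram omega e).
Local Notation isym := (isym omega e).
Local Notation symof := (symof omega e).
Local Notation Z := (square_zero omega).
Local Notation pairing := (pairing J).

Let Jskew : J^T = - J. Proof. exact: gram_skew. Qed.
Let Junit : J \in unitmx. Proof. exact: gram_unit. Qed.

Lemma square_zero_sym S : Z (isym S) <-> sqzero_sym J S.
Proof. exact: square_zero_isym. Qed.

Lemma isym_curve S H T (t : K) :
  isym S + t *: isym H + t ^+ 2 *: isym T = isym (S + t *: H + t ^+ 2 *: T).
Proof. by rewrite !(isymD _ he) !(isymZ he homega). Qed.

Lemma tangent_sym_curve S H T :
  (forall t : K, sqzero_sym J (S + t *: H + t ^+ 2 *: T)) ->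
  tangent Z (isym S) (isym H).
Proof.
move=> h; apply: (@tangent_curve _ _ _ _ _ (isym T)) => t.
by rewrite isym_curve; apply/square_zero_sym.
Qed.

Lemma tangent_sym_line S H : (forall t : K, sqzero_sym J (S + t *: H)) ->
  tangent Z (isym S) (isym H).
Proof.
by move=> h; apply: (@tangent_sym_curve _ _ 0) => t; rewrite scaler0 addr0.
Qed.

(** The linear equations of sp(V) and the quadrics S J S = 0 give the upper bound
    on the tangent space. *)
Lemma tangent_square_zero S v : sqzero_sym J S -> tangent Z (isym S) v ->
  exists H, [/\ v = isym H, H^T = H & S *m J *m H + H *m J *m S = 0].
Proof.
move=> [hS hSS] tv.
have hline (t : K) : symof (isym S + t *: v) = S + t *: symof v.
  by rewrite addrC symof_linear // isymK // addrC.
exists (symof v); split; first by rewrite symofK.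
- apply/matrixP => i j; apply/esym/eqP; rewrite -subr_eq0 [X in _ - X]mxE; apply/eqP.
  apply: (tangent_eq0 (g := fun B => symof B i j - symof B j i) (b := 0) _ _ _ tv).
  + by apply: polyfun_sub; apply: (polymx_symof omega he).
  + move=> B; rewrite -{1}(symofK he homega B) => /square_zero_sym[hB _].
    by rewrite -{1}hB mxE subrr.
  + move=> t; rewrite hline !mxE; have -> : S j i = S i j by rewrite -[in RHS]hS mxE.
    by rewrite mulr0 addr0 opprD addrACA subrr add0r mulrBr.
- apply/matrixP => i j; rewrite [RHS]mxE.
  apply: (tangent_eq0 (g := fun B => (symof B *m J *m symof B) i j)
    (b := (symof v *m J *m symof v) i j) _ _ _ tv).
  + apply: polymx_mul => [|]; last exact: (polymx_symof omega he).
    by apply: polymx_mul; [exact: (polymx_symof omega he)|exact: polymx_const].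
  + move=> B; rewrite -{1}(symofK he homega B) => /square_zero_sym[_ ->].
    by rewrite mxE.
  + move=> t; rewrite hline mulmxDr !mulmxDl hSS add0r.
    rewrite -!scalemxAr -!scalemxAl scalerA -expr2 !mxE; ring.
Qed.

Section FramedPoint.
Variables (F G : 'M[K]_(4, 2)) (L : 'M[K]_(2, 4)) (s : 'M[K]_2).
Hypotheses (F0 : isotropic_frame J F) (LF : L *m F = 1%:M)
  (FG : F^T *m J *m G = 1%:M) (GG : G^T *m J *m G = 0)
  (resol : G *m F^T *m J - F *m G^T *m J = 1%:M) (hs : s^T = s).

Definition frame_dir (x : 'rV[K]_3 * 'rV[K]_3) : 'M[K]_4 :=
  F *m sym2 x.1 *m F^T +
  (G *m sym2 x.2 *m s *m F^T + F *m s *m sym2 x.2 *m G^T).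

Lemma frame_dir_linear (t : K) x y :
  frame_dir (t *: x + y) = t *: frame_dir x + frame_dir y.
Proof.
rewrite /frame_dir /= !sym2_linear !mulmxDr !mulmxDl -!scalemxAr -!scalemxAl.
rewrite !scalerDr -!addrA; congr (_ + _); rewrite !addrA.
by apply/matrixP => i j; rewrite !mxE; ring.
Qed.

Lemma frame_dir_tangent x : tangent Z (isym (F *m s *m F^T)) (isym (frame_dir x)).
Proof.
have Zp : Z (isym (F *m s *m F^T)) by apply/square_zero_sym; apply: sqzero_frame.
rewrite (isymD _ he); apply: tangentD => //.
  apply: tangent_sym_line => t; rewrite scalemxAl scalemxAr -mulmxDl -mulmxDr.
  by apply: sqzero_frame => //; rewrite linearD linearZ /= sym2_tr hs.
apply: (@tangent_sym_curve _ _ (G *m sym2 x.2 *m s *m sym2 x.2 *m G^T)) => t.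
rewrite -moving_frame_expand ?sym2_tr //; apply: sqzero_frame => //.
by apply: (moving_frame_isotropic Jskew F0 FG GG); apply: sym2_tr.
Qed.

Hypothesis us : s \in unitmx.

Lemma dim_tangent_ge6 T : is_tangent_space Z (isym (F *m s *m F^T)) T ->
  (6 <= \dim T)%N.
Proof.
move=> hT; have -> : 6%N = \dim {: ('rV[K]_3 * 'rV[K]_3)%type} by rewrite dimvf.
apply: (@dim_inj_le _ _ _ (fun x => isym (frame_dir x))) => [t x y|x|x].
- by rewrite frame_dir_linear (isym_linear _ he).
- rewrite -(isym0 he homega) => /(can_inj (isymK he homega)) /=.
  move=> /(frame_param_inj F0 LF FG us)[/sym2_inj x1 /sym2_inj x2].
  by rewrite [x]surjective_pairing x1 x2.
- by apply/hT/frame_dir_tangent.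
Qed.

Lemma dim_tangent_le6 T : is_tangent_space Z (isym (F *m s *m F^T)) T ->
  (\dim T <= 6)%N.
Proof.
move=> hT; have -> : 6%N = \dim {: ('rV[K]_3 * 'rV[K]_3)%type} by rewrite dimvf.
apply: (@dim_surj_ge _ _ _ (fun x => isym (frame_dir x))) => [t x y|v /hT vT].
  by rewrite frame_dir_linear (isym_linear _ he).
have [H [-> hH anti]] := tangent_square_zero (sqzero_frame F0 hs) vT.
have [h [k [/sym2_surj[x ->] /sym2_surj[y ->] ->]]] :=
  anticommutant_param Jskew F0 LF FG resol hs us hH anti.
by exists (x, y).
Qed.

End FramedPoint.

Lemma isotropic_framemx (u : V * V) : omega u.1 u.2 = 0 ->
  isotropic_frame J (framemx e u).
Proof.
move=> uv; apply/matrixP => k l; rewrite coordmx_gram // mxE.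
have vu : omega u.2 u.1 = 0 by rewrite omegaC uv oppr0.
by case: k => -[|[|//]] hk; case: l => -[|[|//]] hl //=; rewrite omega_alt.
Qed.

Lemma frame_of_vector (a : 'cV[K]_4) : a != 0 ->
  exists F L, [/\ col 0 F = a, isotropic_frame J F & L *m F = 1%:M].
Proof.
move=> an0; pose u := vecc e a.
have un0 : u != 0 by apply: contraNneq an0 => u0; rewrite -(veccK he a) -/u u0 cvec0.
have [v uv vu] : exists2 v, v \in orthov omega <[u]> & v \notin <[u]>%VS.
  apply/subvPn; apply/negP => /dimvS.
  have := leq_dim_orthov1 omega u fullv; rewrite capfv.
  have -> : \dim {:V} = 4%N by rewrite (size_basis he).
  by rewrite dim_vline un0 => /leq_trans h /h.
have fr : free [:: u; v].
  rewrite (_ : free _ = free [:: v; u]); last exact/perm_free/permEl/(perm_catC [:: u] [:: v]).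
  by rewrite free_cons seq1_free span_seq1 vu un0.
have [L LF] := framemx_left_inverse (u := (u, v)) he fr.
exists (framemx e (u, v)), L; split=> //.
  have := veccK he a; rewrite -/u => <-.
  by apply/matrixP => i j; rewrite !mxE.
apply: isotropic_framemx; rewrite omegaC.
by have /mem_orthovP/(_ u (memv_line u)) /= -> := uv; rewrite oppr0.
Qed.

(** Directions a w^T + w a^T come from the curve (a + t w)(a + t w)^T when c is
    not 0 and by polarising squares when c = 0; squares of vectors orthogonal to
    a are lines in Z, and the mixed term in b and g is obtained by polarising. *)
Lemma rank1_tangent (F G : 'M[K]_(4, 2)) (c : K) x :
  isotropic_frame J F -> F^T *m J *m G = 1%:M -> G^T *m J *m G = 0 ->
  tangent Z (isym (c *: (col 0 F *m (col 0 F)^T)))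
    (isym (singular_dir (col 0 F) (col 1 F) (col 1 G) x)).
Proof.
move=> F0 FG GG.
set a := col 0 F; set b := col 1 F; set g := col 1 G.
have Zx (y : 'cV[K]_4) (t : K) : sqzero_sym J (t *: (y *m y^T)).
  have := @sqzero_outer2 _ J Jskew 0 y 0 t.
  by rewrite scale0r add0r; apply; rewrite /pairing trmx0 !mul0mx mxE.
have Zp : Z (isym (c *: (a *m a^T))) by apply/square_zero_sym.
have tZ t H : tangent Z (isym (c *: (a *m a^T))) (isym H) ->
    tangent Z (isym (c *: (a *m a^T))) (isym (t *: H)).
  by move=> hH; rewrite (isymZ he homega t); apply: tangentZ.
have tD H T : tangent Z (isym (c *: (a *m a^T))) (isym H) ->
    tangent Z (isym (c *: (a *m a^T))) (isym T) ->
    tangent Z (isym (c *: (a *m a^T))) (isym (H + T)).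
  by move=> hH hT; rewrite (isymD _ he H); apply: tangentD.
have torth (y : 'cV[K]_4) : pairing a y = 0 ->
    tangent Z (isym (c *: (a *m a^T))) (isym (y *m y^T)).
  by move=> ay; apply: tangent_sym_line => t; apply: sqzero_outer2.
have aF (M : 'M[K]_(4, 2)) j : pairing a (col j M) = (F^T *m J *m M) 0 j.
  by rewrite frame_pairing.
have ab : pairing a b = 0 by rewrite aF (F0 : _ *m F = 0) mxE.
have ag : pairing a g = 0 by rewrite aF FG mxE.
have mixed (y z : 'cV[K]_4) : (y + z) *m (y + z)^T - y *m y^T - z *m z^T =
    y *m z^T + z *m y^T.
  by apply/matrixP => i j; rewrite !(mxE, big_ord1); ring.
have tN H : tangent Z (isym (c *: (a *m a^T))) (isym H) ->
    tangent Z (isym (c *: (a *m a^T))) (isym (- H)).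
  by rewrite -scaleN1r; apply: (tZ).
apply: (tD).
  (* At the vertex c = 0 of the cone every square spans a line in Z. *)
  have [c0|cn0] := eqVneq c 0.
    have t0 (y : 'cV[K]_4) : tangent Z (isym (c *: (a *m a^T))) (isym (y *m y^T)).
      by apply: tangent_sym_line => t; rewrite c0 scale0r add0r; apply: Zx.
    by rewrite -mixed; apply: (tD); [apply: (tD); [|apply: (tN)]|apply: (tN)]; apply: (t0).
  rewrite -[_ + x.1 *m _](scalerK cn0); apply: (tZ).
  apply: (@tangent_sym_curve _ _ (c *: (x.1 *m x.1^T))) => t.
  rewrite (_ : _ + _ = c *: ((a + t *: x.1) *m (a + t *: x.1)^T)); first exact: Zx.
  by apply/matrixP => i j; rewrite !(mxE, big_ord1); ring.
apply: (tD); [apply: (tD)|]; apply: (tZ); [exact: torth| |exact: torth].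
rewrite -mixed; apply: (tD); [apply: (tD); [|apply: (tN)]|apply: (tN)]; apply: (torth) => //.
by rewrite /pairing mulmxDr mxE -/(pairing a b) -/(pairing a g) ab ag addr0.
Qed.
Lemma dim_tangent_ge7 (a : 'cV[K]_4) (c : K) T : a != 0 ->
  is_tangent_space Z (isym (c *: (a *m a^T))) T -> (7 <= \dim T)%N.
Proof.
move=> /frame_of_vector[F [L [<- F0 LF]]] hT.
have [G [FG GG _]] := symplectic_complement Jskew Junit F0 LF.
have -> : 7%N = \dim {: ('cV[K]_4 * 'rV[K]_3)%type} by rewrite dimvf.
apply: (@dim_inj_le _ _ _
    (fun x => isym (singular_dir (col 0 F) (col 1 F) (col 1 G) x))) => [t x y|x|x].
- by rewrite singular_dir_linear (isym_linear _ he).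
- rewrite -(isym0 he homega) => /(can_inj (isymK he homega)).
  by apply: (@singular_dir_inj _ J Jskew _ _ (col 0 G));
    rewrite frame_pairing ?FG ?GG ?(F0 : F^T *m J *m F = 0) mxE.
- by apply/hT/rank1_tangent.
Qed.

Lemma singular_rank1 (a : 'cV[K]_4) (c : K) : a != 0 ->
  singular_locus Z (isym (c *: (a *m a^T))).
Proof.
move=> an0; have [F [L [_ F0 LF]]] := frame_of_vector an0.
have [G [FG GG resol]] := symplectic_complement Jskew Junit F0 LF.
have Zp : Z (isym (c *: (a *m a^T))).
  apply/square_zero_sym; have := @sqzero_outer2 _ J Jskew 0 a 0 c.
  by rewrite scale0r add0r; apply; rewrite /pairing trmx0 !mul0mx mxE.
have Zq : Z (isym (F *m 1%:M *m F^T)).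
  by apply/square_zero_sym; apply: sqzero_frame => //; rewrite trmx1.
have [Tp hTp] := tangent_space_exists Zp; have [Tq hTq] := tangent_space_exists Zq.
split=> //; exists (isym (F *m 1%:M *m F^T)), Tp, Tq; split=> //.
apply: leq_ltn_trans (dim_tangent_ge7 an0 hTp).
by apply: (dim_tangent_le6 F0 LF FG resol) hTq; rewrite ?trmx1 ?unitmx1.
Qed.

(** For a = 0 the point is the vertex of the cone, written as 0 times the square
    of an arbitrary non-zero vector. *)
Lemma singular_isym_outer (a : 'cV[K]_4) : singular_locus Z (isym (a *m a^T)).
Proof.
have [->|an0] := eqVneq a 0; last by rewrite -[X in isym X]scale1r; apply: singular_rank1.
have ? : (\col_(i < 4) 1 : 'cV[K]_4) != 0.
  apply/eqP => /matrixP/(_ 0 0); rewrite !mxE => /eqP; exact/negP/oner_neq0.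
rewrite mul0mx -(scale0r ((\col_(i < 4) 1) *m (\col_(i < 4) 1)^T)).
exact: singular_rank1.
Qed.

Lemma sym2_det0 (s : 'M[K]_2) : s^T = s -> \det s = 0 ->
  exists c (l : 'cV[K]_2), l != 0 /\ s = c *: (l *m l^T).
Proof.
move=> hs; rewrite det_mx2 => /eqP; rewrite subr_eq0 => /eqP d0.
have s10 : s 1 0 = s 0 1 by rewrite -[in RHS]hs mxE.
have s_ i j i' j' : val i = val i' -> val j = val j' -> s i j = s i' j'.
  by move=> /val_inj -> /val_inj ->.
have [s00|s00] := eqVneq (s 0 0) 0.
  have s01 : s 0 1 = 0.
    by move/eqP: d0; rewrite s00 mul0r s10 eq_sym mulf_eq0 orbb => /eqP.
  exists (s 1 1), (delta_mx 1 0); split.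
    by apply/eqP => /matrixP/(_ 1 0); rewrite !mxE /= => /eqP; apply/negP/oner_neq0.
  apply/matrixP => i j; rewrite !(mxE, big_ord1).
  case: i => -[|[|//]] hi; case: j => -[|[|//]] hj; rewrite /= ?mulr0 ?mul0r ?mulr0 ?mulr1.
  - by rewrite -s00; apply: s_.
  - by rewrite -s01; apply: s_.
  - by rewrite -s01 -s10; apply: s_.
  - exact: s_.
exists (s 0 0)^-1, (\col_i s 0 i); split.
  by apply/eqP => /matrixP/(_ 0 0); rewrite !mxE => /eqP; apply/negP.
apply/matrixP => i j; rewrite !(mxE, big_ord1).
apply: (mulfI s00); rewrite mulVKf //.
case: i => -[|[|//]] hi; case: j => -[|[|//]] hj.
- by congr (_ * _); apply: s_.
- by rewrite (s_ (Ordinal hi) (Ordinal hj) 0 1) // (s_ 0 (Ordinal hi) 0 0) //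
    (s_ 0 (Ordinal hj) 0 1).
- by rewrite (s_ (Ordinal hi) (Ordinal hj) 1 0) // (s_ 0 (Ordinal hi) 0 1) //
    (s_ 0 (Ordinal hj) 0 0) // s10 mulrC.
- by rewrite (s_ (Ordinal hi) (Ordinal hj) 1 1) // (s_ 0 (Ordinal hi) 0 1) //
    (s_ 0 (Ordinal hj) 0 1) // d0 s10.
Qed.

Lemma Ztilde_frame (B : 'End(V)) (u : V * V) : free [:: u.1; u.2] ->
  Ztilde_set omega (B, <<[:: u.1; u.2]>>%VS) ->
  isotropic_frame J (framemx e u) /\
  exists s, s^T = s /\ B = isym (framemx e u *m s *m (framemx e u)^T).
Proof.
move=> fr [/= ZB [/(isotropicP) Uiso _] BU].
have u1 : u.1 \in <<[:: u.1; u.2]>>%VS by rewrite memv_span ?mem_head.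
have u2 : u.2 \in <<[:: u.1; u.2]>>%VS by rewrite memv_span // !inE eqxx orbT.
have F0 : isotropic_frame J (framemx e u) by apply: isotropic_framemx; apply: Uiso.
split=> //.
have [L LF] := framemx_left_inverse he fr.
have [G [FG GG resol]] := symplectic_complement Jskew Junit F0 LF.
have [hS _] : sqzero_sym J (symof B) by apply/square_zero_sym; rewrite symofK.
have B0 x : x \in <<[:: u.1; u.2]>>%VS -> B x = 0.
  by move=> xU; apply/eqP; rewrite -memv0 -BU memv_img.
have [|s [ss sE]] := sym_of_image Jskew resol hS.
  apply: trmx_inj; rewrite trmx0.
  have : mxe B *m framemx e u = 0.
    rewrite mul_framemx // !B0 //; apply/matrixP => i k; rewrite !mxE.
    by case: k => -[|[|//]] hk /=; rewrite linear0.
  rewrite (mxe_symof he homega) trmx_mul (trmx_mul _ J) trmxK Jskew hS mulNmx mulmxN mulmxA => ->.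
  by rewrite oppr0.
by exists s; split=> //; rewrite -sE symofK.
Qed.

(** As B has square zero its image is isotropic; it lies in a Lagrangian plane U,
    and B kills U because omega (B u) v = - omega u (B v) = 0. *)
Lemma sigma_surjective (B : 'End(V)) : Z B ->
  exists u : V * V, free [:: u.1; u.2] /\ Ztilde_set omega (B, <<[:: u.1; u.2]>>%VS).
Proof.
move=> ZB; have [spB BB] := ZB.
have spB' x y : omega (B x) y = - omega x (B y).
  by apply/eqP; rewrite -addr_eq0 spB.
have Iiso : isotropic omega (limg B).
  apply/isotropicP => _ _ /memv_imgP[x _ ->] /memv_imgP[y _ ->].
  have /lfunP/(_ y) := BB; rewrite !lfunE /= spB' => ->.
  by rewrite linear0r oppr0.
have [U [Umax IU]] := isotropic_extend Iiso.
have [u [fr UE]] := maximal_isotropic_frame he homega Umax.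
exists u; split=> //; rewrite -UE; split=> //=.
apply/eqP; rewrite -subv0; apply/subvP => _ /memv_imgP[x xU ->].
rewrite memv0; apply/eqP; apply: (omega_nondeg homega) => y; rewrite spB'.
have [/isotropicP Uiso _] := Umax.
by rewrite Uiso ?oppr0 //; apply: (subvP IU); rewrite memv_img ?memvf.
Qed.

(** The normal form on which everything rests: B is a quadratic form s on a
    Lagrangian plane, of rank at most one exactly when det s = 0. *)
Lemma square_zero_normal_form (B : 'End(V)) : Z B ->
  exists (F : 'M[K]_(4, 2)) (L : 'M[K]_(2, 4)) (s : 'M[K]_2),
    [/\ isotropic_frame J F, L *m F = 1%:M, s^T = s & B = isym (F *m s *m F^T)].
Proof.
move=> /sigma_surjective[u [fr /(Ztilde_frame fr)[F0 [s [ss ->]]]]].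
have [L LF] := framemx_left_inverse he fr.
by exists (framemx e u), L, s.
Qed.

Lemma dim_tangent_min (B : 'End(V)) T : Z B -> is_tangent_space Z B T ->
  (6 <= \dim T)%N.
Proof.
move=> /square_zero_normal_form[F [L [s [F0 LF ss ->]]]] hT.
have [G [FG GG resol]] := symplectic_complement Jskew Junit F0 LF.
have [us|] := boolP (s \in unitmx); first exact: (dim_tangent_ge6 F0 LF FG GG ss us hT).
rewrite unitmxE unitfE negbK => /eqP /(sym2_det0 ss)[c [l [ln0 sE]]].
apply: ltnW; apply: (@dim_tangent_ge7 (F *m l) c).
  apply: contraNneq ln0 => Fl; apply/eqP.
  by rewrite -[l]mul1mx -LF -mulmxA Fl mulmx0.
by move: hT; rewrite sE trmx_mul -scalemxAr -scalemxAl !mulmxA.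
Qed.

Lemma singular_det0 F L s : isotropic_frame J F -> L *m F = 1%:M -> s^T = s ->
  singular_locus Z (isym (F *m s *m F^T)) -> \det s = 0.
Proof.
move=> F0 LF ss [Zp [q [Tp [Tq [Zq hTp hTq lt]]]]].
have [G [FG GG resol]] := symplectic_complement Jskew Junit F0 LF.
apply/eqP; apply: contraTT lt => us; rewrite -leqNgt.
apply: leq_trans (dim_tangent_min Zq hTq).
by apply: (dim_tangent_le6 F0 LF FG resol ss) hTp; rewrite unitmxE unitfE.
Qed.

End SingularLocus.

(** * The ideal of the rank one symmetric matrices *)

Section VeroneseIdeal.
Variables (K : numFieldType) (V : vectType K) (omega : {skew_symmetric V}).
Variables (n : nat) (e : n.-tuple V).
Hypothesis he : basis_of {:V} e.
Hypothesis homega : nondegenerate omega.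

Local Notation mxe := (matrix_in_basis e).
Local Notation J := (gram omega e).
Local Notation isym := (isym omega e).
Local Notation symof := (symof omega e).
Local Notation sp := (sp_alg omega).
Local Notation minor_index := ({ffun 'I_2 -> 'I_n} * {ffun 'I_2 -> 'I_n})%type.
Implicit Types (g h f : 'End(V) -> K) (s t p q : seq 'I_n) (i j k l : 'I_n).

Let symof_sym B i j : sp B -> symof B i j = symof B j i.
Proof.
by rewrite -{1}(symofK he homega B) => /(sp_isym he homega) hB; rewrite -[in LHS]hB mxE.
Qed.

Definition in_minor_ideal g : Prop :=
  exists a : minor_index -> 'End(V) -> K, (forall rc, polyfun (a rc)) /\
    forall B, sp B -> g B = \sum_rc a rc B * minor2 e rc B.

Definition congr_minors g h : Prop := in_minor_ideal (fun B => g B - h B).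

Lemma in_ideal_ext g h : (forall B, sp B -> g B = h B) ->
  in_minor_ideal h -> in_minor_ideal g.
Proof. by move=> gh [a [ap ha]]; exists a; split=> // B sB; rewrite gh // ha. Qed.

Lemma in_ideal0 : in_minor_ideal (fun _ => 0).
Proof.
exists (fun _ _ => 0); split=> [rc|B _]; first exact: polyfun_const.
by rewrite big1 // => rc _; rewrite mul0r.
Qed.

Lemma in_idealD g h :
  in_minor_ideal g -> in_minor_ideal h -> in_minor_ideal (fun B => g B + h B).
Proof.
move=> [a [ap ha]] [b [bp hb]]; exists (fun rc B => a rc B + b rc B); split.
  by move=> rc; apply: polyfun_add.
move=> B sB; rewrite ha // hb // -big_split; apply: eq_bigr => rc _.
by rewrite mulrDl.
Qed.

Lemma in_idealM g h :
  polyfun g -> in_minor_ideal h -> in_minor_ideal (fun B => g B * h B).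
Proof.
move=> gp [b [bp hb]]; exists (fun rc B => g B * b rc B); split.
  by move=> rc; apply: polyfun_mul.
by move=> B sB; rewrite hb // big_distrr /=; apply: eq_bigr => rc _; rewrite mulrA.
Qed.

Lemma in_ideal_sum (I : Type) (r : seq I) (P : pred I) (g : I -> 'End(V) -> K) :
  (forall x, P x -> in_minor_ideal (g x)) ->
  in_minor_ideal (fun B => \sum_(x <- r | P x) g x B).
Proof.
move=> hg; elim: r => [|x r IH].
  by apply: in_ideal_ext in_ideal0 => B _; rewrite big_nil.
have [Px|Px] := boolP (P x); last first.
  by apply: in_ideal_ext IH => B _; rewrite big_cons (negPf Px).
by apply: in_ideal_ext (in_idealD (hg _ Px) IH) => B _; rewrite big_cons Px.
Qed.

Lemma in_ideal_minor rc : in_minor_ideal (minor2 e rc).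
Proof.
exists (fun rc' _ => (rc' == rc)%:R); split=> [rc'|B _]; first exact: polyfun_const.
rewrite (bigD1 rc) //= eqxx mul1r big1 ?addr0 // => rc' /negPf ->.
by rewrite mul0r.
Qed.

Lemma congr_refl g h : (forall B, sp B -> g B = h B) -> congr_minors g h.
Proof. by move=> gh; apply: in_ideal_ext in_ideal0 => B sB; rewrite gh // subrr. Qed.

Lemma congr_trans g h f :
  congr_minors g h -> congr_minors h f -> congr_minors g f.
Proof.
move=> gh hf; apply: in_ideal_ext (in_idealD gh hf) => B _.
by rewrite addrA subrK.
Qed.

Lemma congr_add g g' h h' : congr_minors g g' -> congr_minors h h' ->
  congr_minors (fun B => g B + h B) (fun B => g' B + h' B).
Proof.
by move=> gg hh; apply: in_ideal_ext (in_idealD gg hh) => B _; rewrite opprD addrACA.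
Qed.

Lemma congr_mulr f g h : polyfun f -> congr_minors g h ->
  congr_minors (fun B => f B * g B) (fun B => f B * h B).
Proof.
by move=> fp gh; apply: in_ideal_ext (in_idealM fp gh) => B _; rewrite mulrBr.
Qed.

Definition index_pair i j : {ffun 'I_2 -> 'I_n} := [ffun z => if z == 0 then i else j].

Lemma minor2_pair i j k l B : minor2 e (index_pair i j, index_pair k l) B =
  mxe B i k * mxe B j l - mxe B i l * mxe B j k.
Proof.
have E (r c : {ffun 'I_2 -> 'I_n}) a b :
  mxsub r c (mxe B) a b = mxe B (r a) (c b) by rewrite mxE.
by rewrite /minor2 det_mx2 !E !ffunE.
Qed.

(** The entries of the symmetric matrix are those of the matrix of B times the
    inverse Gram matrix, so its minors are linear combinations of minors of
    B. *)
Lemma sym_minor_in_ideal i j k l : in_minor_ideal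
  (fun B => symof B i j * symof B k l - symof B i l * symof B k j).
Proof.
pose Q := invmx J.
apply: (@in_ideal_ext _ (fun B => \sum_x \sum_y (Q x j * Q y l) *
    minor2 e (index_pair i k, index_pair x y) B)) => [B _|].
  rewrite ![symof B _ _]mxE; do 2!rewrite big_distrlr.
  rewrite [X in _ - X]exchange_big -sumrB /=.
  apply: eq_bigr => x _; rewrite -sumrB; apply: eq_bigr => y _.
  rewrite minor2_pair -/Q; ring.
apply: in_ideal_sum => x _; apply: in_ideal_sum => y _; apply: in_idealM.
  exact: polyfun_const.
exact: in_ideal_minor.
Qed.

(** The monomial in the entries of the symmetric matrix obtained by pairing off
    consecutive indices; on the matrices v v^T it takes the value of the product
    of the coordinates v_i.  An unpaired index gives 0, so that exchanging
    adjacent indices is a congruence for all lists. *)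
Fixpoint pair_monomial s (B : 'End(V)) : K :=
  match s with
  | [::] => 1
  | [:: _] => 0
  | i :: j :: s' => symof B i j * pair_monomial s' B
  end.
Local Notation mon := pair_monomial.

Lemma even_ind (P : seq 'I_n -> Prop) :
  P [::] -> (forall i, P [:: i]) -> (forall i j s, P s -> P (i :: j :: s)) ->
  forall s, P s.
Proof.
move=> P0 P1 P2 s; suff [] : P s /\ forall i, P (i :: s) by [].
elim: s => [|i s [IH IH1]]; split=> // j; exact: P2.
Qed.

Lemma pair_monomial_poly s : polyfun (mon s).
Proof.
elim/even_ind: s => [|i|i j s IH]; try exact: polyfun_const.
by apply: polyfun_mul IH; apply: (polymx_symof omega he).
Qed.

Lemma pair_monomial_cat s t B :
  ~~ odd (size s) -> mon (s ++ t) B = mon s B * mon t B.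
Proof.
elim/even_ind: s => [|i|i j s IH] //=; first by rewrite mul1r.
by rewrite negbK => /IH ->; rewrite mulrA.
Qed.

Lemma pair_monomial_swap p i j q :
  congr_minors (mon (p ++ i :: j :: q)) (mon (p ++ j :: i :: q)).
Proof.
elim/even_ind: p => [|k|k l p IH] /=.
- by apply: congr_refl => B sB; rewrite symof_sym.
- case: q => [|l q]; first by apply: congr_refl => B _; rewrite !mulr0.
  apply: (@in_ideal_ext _ (fun B => mon q B *
    (symof B k i * symof B l j - symof B k j * symof B l i))) => [B sB|].
    by rewrite (symof_sym j l sB) (symof_sym i l sB); ring.
  by apply: in_idealM; [exact: pair_monomial_poly|exact: sym_minor_in_ideal].
- by apply: congr_mulr IH; apply: (polymx_symof omega he).
Qed.

(** Modulo the minors a monomial only depends on the multiset of its indices: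
    adjacent indices can be exchanged, by symmetry inside a pair and by a 2x2
    minor across two pairs. *)
Lemma pair_monomial_perm s t p :
  perm_eq s t -> congr_minors (mon (p ++ s)) (mon (p ++ t)).
Proof.
elim: s t p => [|i s IH] t p.
  by rewrite perm_sym => /perm_nilP ->; apply: congr_refl.
move=> st; have it : i \in t by rewrite -(perm_mem st) mem_head.
case/splitPr: t / it st => t1 t2 st.
have {}st : perm_eq s (t1 ++ t2).
  by rewrite -(perm_cons i); apply: (perm_trans st); rewrite -cat1s perm_catCA.
have := IH _ (rcons p i) st; rewrite !cat_rcons => h; apply: congr_trans h _.
elim: t1 p {st IH} => [|j t1 IH] p /=; first exact: congr_refl.
apply: congr_trans (pair_monomial_swap _ _ _ _) _.
by have := IH (rcons p j); rewrite !cat_rcons.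
Qed.

Definition even_monomials (M : seq (K * seq 'I_n)) : bool :=
  all (fun m => ~~ odd (size m.2)) M.

Definition combination (M : seq (K * seq 'I_n)) (B : 'End(V)) : K :=
  \sum_(m <- M) m.1 * mon m.2 B.

Definition normalizable g : Prop :=
  exists M, even_monomials M /\ congr_minors g (combination M).

Lemma normalizable_ext g h : (forall B, sp B -> g B = h B) ->
  normalizable h -> normalizable g.
Proof.
move=> gh [M [eM hM]]; exists M; split=> //.
by apply: congr_trans hM; apply: congr_refl.
Qed.

Lemma normalizable_monomial (c : K) s : ~~ odd (size s) ->
  normalizable (fun B => c * mon s B).
Proof.
move=> es; exists [:: (c, s)]; split; first by rewrite /even_monomials /= es.
by apply: congr_refl => B _; rewrite /combination big_seq1.
Qed.

Lemma normalizable_add g h :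
  normalizable g -> normalizable h -> normalizable (fun B => g B + h B).
Proof.
move=> [M [eM hM]] [N [eN hN]]; exists (M ++ N); split.
  by rewrite /even_monomials all_cat; apply/andP.
apply: congr_trans (congr_add hM hN) _; apply: congr_refl => B _.
by rewrite /combination big_cat.
Qed.

Lemma normalizable_sum (I : Type) (r : seq I) (g : I -> 'End(V) -> K) :
  (forall x, normalizable (g x)) -> normalizable (fun B => \sum_(x <- r) g x B).
Proof.
move=> hg; elim: r => [|x r IH].
  apply: (@normalizable_ext _ (fun B => 0 * mon [::] B)) => [B _|].
    by rewrite big_nil mul0r.
  exact: normalizable_monomial.
by apply: normalizable_ext (normalizable_add (hg x) IH) => B _; rewrite big_cons.
Qed.

Lemma combination_poly M : polyfun (combination M).
Proof.
apply: polyfun_sum => m; apply: polyfun_mul; first exact: polyfun_const.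
exact: pair_monomial_poly.
Qed.

Lemma normalizable_mul g h : polyfun h ->
  normalizable g -> normalizable h -> normalizable (fun B => g B * h B).
Proof.
move=> hp [M [eM hM]] [N [eN hN]].
exists [seq (m.1 * m'.1, m.2 ++ m'.2) | m <- M, m' <- N]; split.
  apply/allP => _ /allpairsP[[m m'] /= [mM mN ->]] /=; rewrite size_cat oddD.
  by rewrite (negPf (allP eM _ mM)) (negPf (allP eN _ mN)).
apply: (@congr_trans _ (fun B => combination M B * h B)).
  have := congr_mulr hp hM; apply: in_ideal_ext => B _.
  by rewrite ![h B * _]mulrC.
apply: congr_trans (congr_mulr (combination_poly M) hN) _.
apply: congr_refl => B _; rewrite /combination big_allpairs_dep big_distrl /=.
rewrite [LHS]big_seq [RHS]big_seq; apply: eq_bigr => m mM; rewrite big_distrr /=.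
apply: eq_bigr => m' _; rewrite pair_monomial_cat; last exact: (allP eM).
by rewrite mulrACA.
Qed.

Lemma polyfun_normalizable g : polyfun g -> normalizable g.
Proof.
elim=> [c|l|g1 g2 _ IH1 _ IH2|g1 g2 _ IH1 hg2 IH2].
- apply: (@normalizable_ext _ (fun B => c * mon [::] B)) => [B _|].
    by rewrite mulr1.
  exact: normalizable_monomial.
- apply: (@normalizable_ext _ (fun B => \sum_(ij : 'I_n * 'I_n)
      l (isym (delta_mx ij.1 ij.2)) * mon [:: ij.1; ij.2] B)) => [B _|].
    rewrite -{1}(symofK he homega B) [X in isym X]matrix_sum_delta pair_big /=.
    rewrite (big_morph _ (isymD omega he) (isym0 he homega)) linear_sum.
    apply: eq_bigr => ij _; rewrite (isymZ he homega) linearZ /= mulr1.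
    exact: mulrC.
  by apply: normalizable_sum => ij; apply: normalizable_monomial.
- exact: normalizable_add.
- exact: normalizable_mul.
Qed.

(** Exponents for the substitution v_i = z^(N^i): they separate the multisets
    of fewer than N indices. *)
Definition index_weight N s : nat := (\sum_(i <- s) N ^ i)%N.

Lemma digits_inj m N (a b : nat -> nat) :
  (forall d, (a d < N)%N) -> (forall d, (b d < N)%N) ->
  (\sum_(i < m) a i * N ^ i = \sum_(i < m) b i * N ^ i)%N ->
  forall d, (d < m)%N -> a d = b d.
Proof.
elim: m a b => // m IH a b aN bN.
have shift (c : nat -> nat) : (\sum_(i < m.+1) c i * N ^ i =
    c 0 + (\sum_(i < m) c i.+1 * N ^ i) * N)%N.
  rewrite big_ord_recl expn0 muln1 big_distrl /=; congr (_ + _)%N.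
  by apply: eq_bigr => i _; rewrite /bump /= add1n expnSr mulnA.
have N0 : (0 < N)%N by exact: leq_ltn_trans (leq0n _) (aN 0%N).
rewrite !shift => E.
have a0 : a 0%N = b 0%N.
  by have := congr1 (modn^~ N) E; rewrite !(addnC _ (_ * N)%N) !modnMDl !modn_small.
move: E; rewrite a0 => /addnI/eqP; rewrite eqn_pmul2r // => /eqP E.
by case=> [|d] //; rewrite ltnS => dm; apply: (IH (fun d => a d.+1) (fun d => b d.+1)).
Qed.

Lemma index_weight_perm N s t : (size s < N)%N -> (size t < N)%N ->
  index_weight N s = index_weight N t -> perm_eq s t.
Proof.
move=> sN tN; have cN u : (size u < N)%N ->
    forall d : nat, (count (fun j : 'I_n => (j == d :> nat)) u < N)%N.
  by move=> uN d; apply: leq_ltn_trans (count_size _ _) uN.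
have wE u : index_weight N u =
    (\sum_(i < n) count (fun j : 'I_n => (j == i :> nat)) u * N ^ i)%N.
  rewrite /index_weight; elim: u => [|j u IH].
    by rewrite big_nil big1 // => i _; rewrite mul0n.
  rewrite big_cons IH [in RHS](bigD1 j) //= eqxx mulnDl mul1n -addnA.
  congr (_ + _)%N; rewrite (bigD1 j) //=; congr (_ + _)%N.
  apply: eq_bigr => i; rewrite eq_sym => /negPf ij.
  by rewrite (_ : (j == i :> nat) = false) // -ij.
rewrite !wE => /(digits_inj (cN s sN) (cN t tN)) E.
by apply/allP => i _; apply/eqP; have := E i (ltn_ord i).
Qed.

(** Vanishing of the polynomial means that the coefficients attached to each
    exponent add up to zero, so the exponents may be replaced by arbitrary
    values. *)
Lemma poly_eq0_linear (M : seq (K * seq 'I_n)) (w : seq 'I_n -> nat) (f : nat -> K) :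
  (forall z : K, \sum_(m <- M) m.1 * z ^+ w m.2 = 0) ->
  \sum_(m <- M) m.1 * f (w m.2) = 0.
Proof.
move=> h; pose P : {poly K} := \sum_(m <- M) m.1 *: 'X^(w m.2).
have P0 : P = 0.
  apply: poly_eq0_fun => z; rewrite horner_sum -[RHS](h z).
  by apply: eq_bigr => m _; rewrite hornerZ hornerXn.
pose b := (\max_(m <- M) w m.2).+1.
have fE m : m \in M -> f (w m.2) = \sum_(i < b) ('X^(w m.2))`_i * f i.
  move=> mM; have wb : (w m.2 < b)%N.
    by rewrite ltnS; apply: (@leq_bigmax_seq _ M xpredT (fun m => w m.2)).
  rewrite (bigD1 (Ordinal wb)) //= coefXn eqxx mul1r big1 ?addr0 // => i.
  by rewrite -val_eqE /= => /negPf iw; rewrite coefXn iw mul0r.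
transitivity (\sum_(i < b) P`_i * f i); last first.
  by rewrite big1 // => i _; rewrite P0 coef0 mul0r.
under [RHS]eq_bigr => i _ do rewrite coef_sum big_distrl /=.
rewrite exchange_big /= [LHS]big_seq [RHS]big_seq; apply: eq_bigr => m mM.
rewrite fE // big_distrr /=; apply: eq_bigr => i _.
by rewrite coefZ mulrA.
Qed.

Lemma minor2_outer rc (v : 'cV[K]_n) : minor2 e rc (isym (v *m v^T)) = 0.
Proof.
have E a b : mxsub rc.1 rc.2 (mxe (isym (v *m v^T))) a b =
    v (rc.1 a) 0 * (v^T *m J) 0 (rc.2 b).
  by rewrite mxE mxe_isym // -mulmxA mxE big_ord1.
by rewrite /minor2 det_mx2 !E; ring.
Qed.

Lemma pair_monomial_outer s (v : 'cV[K]_n) : ~~ odd (size s) ->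
  mon s (isym (v *m v^T)) = \prod_(i <- s) v i 0.
Proof.
elim/even_ind: s => [|i|i j s IH] //=; first by rewrite big_nil.
rewrite negbK => /IH ->; rewrite !big_cons isymK // mulrA; congr (_ * _).
by rewrite mxE big_ord1 mxE.
Qed.

(** Write g modulo the minors as a combination of monomials.  Monomials with the
    same multiset of indices are congruent, and those with distinct multisets
    restrict to distinct monomials in v; hence the coefficients of each class
    add up to zero. *)
Lemma veronese_ideal g : polyfun g ->
  (forall v : 'cV[K]_n, g (isym (v *m v^T)) = 0) -> in_minor_ideal g.
Proof.
move=> hg g0; have [M [eM hM]] := polyfun_normalizable hg.
suff hc : congr_minors (combination M) (fun _ => 0).
  by apply: in_ideal_ext (congr_trans hM hc) => B _; rewrite subr0.
pose N := (\max_(m <- M) size m.2).+1.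
have sN m : m \in M -> (size m.2 < N)%N.
  by move=> mM; rewrite ltnS; apply: (@leq_bigmax_seq _ M xpredT (fun m => size m.2)).
pose w := index_weight N.
have hz (z : K) : \sum_(m <- M) m.1 * z ^+ w m.2 = 0.
  pose v : 'cV[K]_n := \col_i z ^+ (N ^ i)%N.
  have spv : sp (isym (v *m v^T)) by apply/sp_isym => //; rewrite trmx_mul trmxK.
  have [a [_ /(_ _ spv)]] := hM.
  rewrite g0 sub0r big1 => [|rc _]; last by rewrite minor2_outer mulr0.
  move=> /eqP; rewrite oppr_eq0 => /eqP E; rewrite -[RHS]E.
  rewrite /combination [LHS]big_seq [RHS]big_seq; apply: eq_bigr => m mM.
  rewrite pair_monomial_outer ?(allP eM) //; congr (_ * _).
  rewrite /w /index_weight; elim: (m.2) => [|i s IH]; first by rewrite !big_nil.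
  by rewrite !big_cons exprD IH mxE.
(* One chosen monomial in each class. *)
pose rep d := (nth (0, [::]) M (find (fun m => w m.2 == d) M)).2.
apply: (@congr_trans _ (fun B => \sum_(m <- M) m.1 * mon (rep (w m.2)) B)); last first.
  apply: congr_refl => B _.
  exact: (poly_eq0_linear (fun d => mon (rep d) B) hz).
apply: (@in_ideal_ext _ (fun B => \sum_(m <- M | m \in M)
    m.1 * (mon m.2 B - mon (rep (w m.2)) B))) => [B _|].
  rewrite /combination -sumrB -big_seq; apply: eq_bigr => m _.
  by rewrite mulrBr.
apply: in_ideal_sum => m mM; apply: in_idealM; first exact: polyfun_const.
apply: (pair_monomial_perm [::]).
have hm : has (fun m' => w m'.2 == w m.2) M by apply/hasP; exists m.
apply: (@index_weight_perm N); rewrite ?sN //.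
  by apply: mem_nth; rewrite -has_find.
by have /eqP := nth_find (0, [::]) hm.
Qed.

End VeroneseIdeal.

(** * The blow-up *)

Section BlowUp.
Variables (K : numFieldType) (V : vectType K) (omega : {skew_symmetric V}).
Variable (e : 4.-tuple V).
Hypothesis he : basis_of {:V} e.
Hypothesis homega : nondegenerate omega.

Local Notation mxe := (matrix_in_basis e).
Local Notation J := (gram omega e).
Local Notation isym := (isym omega e).
Local Notation symof := (symof omega e).
Local Notation Z := (square_zero omega).
Local Notation minor_index := ({ffun 'I_2 -> 'I_4} * {ffun 'I_2 -> 'I_4})%type.
Local Notation E := {ffun minor_index -> K^o}.
Implicit Types (F : 'M[K]_(4, 2)) (s N : 'M[K]_2) (rc : minor_index) (y : E).

Let Jskew : J^T = - J. Proof. exact: gram_skew. Qed.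
Let Junit : J \in unitmx. Proof. exact: gram_unit. Qed.

Lemma coordZ (c : K) y rc : (c *: y) rc = c * (y rc : K).
Proof. by rewrite ffunE. Qed.

Definition minors (B : 'End(V)) : E := [ffun rc => minor2 e rc B].

(** The direction of the vector of minors at the points F s F^T with s
    invertible; it also makes sense where the minors vanish. *)
Definition frame_minors F : E := minors (isym (F *m F^T)).

Lemma minor2_frame F s rc : minor2 e rc (isym (F *m s *m F^T)) =
  \det s * (\det (rowsub rc.1 F) * \det (colsub rc.2 (F^T *m J))).
Proof.
rewrite /minor2 mxe_isym // -mulmxA [mxsub _ _ (F *m s *m _)]mxsub_mul.
rewrite -mul_rowsub_mx !det_mulmx.
by rewrite [_ * \det s]mulrC mulrA.
Qed.

Lemma frame_minorsE F rc : frame_minors F rc =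
  \det (rowsub rc.1 F) * \det (colsub rc.2 (F^T *m J)).
Proof. by have := minor2_frame F 1%:M rc; rewrite ffunE mulmx1 det1 mul1r. Qed.

Lemma minors_frame F s : minors (isym (F *m s *m F^T)) = \det s *: frame_minors F.
Proof.
by apply/ffunP => rc; rewrite [LHS]ffunE minor2_frame [RHS]ffunE frame_minorsE.
Qed.

(** Hence its line only depends on the plane spanned by the frame. *)
Lemma frame_minors_mul F N : frame_minors (F *m N) = \det N ^+ 2 *: frame_minors F.
Proof.
rewrite /frame_minors trmx_mul !mulmxA -(mulmxA F) minors_frame det_mulmx.
by rewrite det_tr expr2.
Qed.

Lemma frame_minors_neq0 F L : L *m F = 1%:M -> frame_minors F != 0.
Proof.
move=> LF; have rowsub_unit (A : 'M[K]_(4, 2)) M : M *m A = 1%:M ->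
    exists r : {ffun 'I_2 -> 'I_4}, \det (rowsub r A) != 0.
  move=> MA; have fA : row_full A by apply/row_fullP; exists M.
  exists [ffun i => fullrankfun fA i]; rewrite -unitfE -unitmxE.
  rewrite (_ : rowsub _ A = rowsub (fullrankfun fA) A) ?fullrowsub_unit //.
  by apply/matrixP => i j; rewrite [LHS]mxE [RHS]mxE ffunE.
have [r hr] := rowsub_unit _ _ LF.
have [c hc] : exists c : {ffun 'I_2 -> 'I_4}, \det (rowsub c (F^T *m J)^T) != 0.
  apply: (rowsub_unit _ (L *m (invmx J)^T)).
  by rewrite trmx_mul trmxK mulmxA -(mulmxA L) -trmx_mul mulmxV // trmx1 mulmx1.
apply/eqP => /ffunP/(_ (r, c)); rewrite frame_minorsE ffunE /= => /eqP.
apply/negP; rewrite mulf_neq0 //.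
by rewrite -det_tr trmx_mxsub.
Qed.

(** The vector frame_minors F lies over F s F^T in the blow-up even if s is
    degenerate: along s + t the relation P holds wherever det (s + t) is
    non-zero, that is up to finitely many t, hence also at t = 0. *)
Lemma minors_square_zero_frame F s (c : K) (y : E) :
  isotropic_frame J F -> s^T = s -> y \in <[frame_minors F]>%VS ->
  forall d (P : 'End(V) * E -> K), polyfun P -> homogeneous_snd d P ->
    (forall B, Z B -> P (B, minors B) = 0) -> P (isym (F *m s *m F^T), y) = 0.
Proof.
move=> F0 ss /vlineP[b ->] d P Pp Ph P0; rewrite Ph.
suff -> : P (isym (F *m s *m F^T), frame_minors F) = 0 by rewrite mulr0.
pose st (t : K^o) : 'M[K]_2 := s + (t : K)%:M.
have stp : polymx st.
  apply: polymx_add; first exact: polymx_const.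
  move=> i j; apply: polyfun_linear => a u v; rewrite !mxE.
  by rewrite mulrnAr -mulrnDl.
have [q hq] : exists q : {poly K}, forall t : K,
    P (isym (F *m st t *m F^T), frame_minors F) = q.[t].
  apply: (@polyfun_curve _ (fun t : K^o => P (isym (F *m st t *m F^T), frame_minors F))).
  apply: (@polyfun_comp _ _ _ (fun t => (isym (F *m st t *m F^T), frame_minors F))) => //.
  apply: polymap_pair.
    apply: polymap_endo => //; apply: polymx_mul; last exact: polymx_const.
    apply: polymx_mul; last exact: polymx_const.
    by apply: polymx_mul; [exact: polymx_const|].
  by move=> l; apply: polyfun_const.
(* The determinant of s + t as a polynomial in t. *)
pose D : {poly K} := ('X + (s 0 0)%:P) * ('X + (s 1 1)%:P) - (s 0 1 * s 1 0)%:P.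
have hD (t : K) : D.[t] = \det (st t).
  by rewrite det_mx2 !mxE /= !hornerE !mulr1n ![_ + t]addrC.
have Dq : D ^+ d * q = 0.
  apply: poly_eq0_fun => t; rewrite hornerM horner_exp hD -hq -Ph -minors_frame.
  apply: P0; apply/square_zero_sym => //; apply: sqzero_frame => //.
  by rewrite /st linearD /= ss tr_scalar_mx.
have Dn0 : D != 0.
  apply/eqP => /(congr1 (fun p : {poly K} => size p)).
  have n0 (a : K) : 'X + a%:P != 0 by rewrite -size_poly_eq0 size_XaddC.
  have sz : size (('X + (s 0 0)%:P) * ('X + (s 1 1)%:P)) = 3%N.
    by rewrite (size_mul (n0 _) (n0 _)) !size_XaddC.
  rewrite size_poly0 size_polyDl ?size_polyN sz //.
  exact: leq_ltn_trans (size_polyC_leq1 _) _.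
move/eqP: Dq; rewrite mulf_eq0 expf_eq0 (negPf Dn0) andbF /= => /eqP q0.
have := hq 0; rewrite q0 horner0 => <-.
by rewrite /st raddf0 addr0.
Qed.

(** If y is the vector of minors of B, the columns are combinations of the columns
    c 0 and c 1 of B chosen so that the rows r 0 and r 1 form the scalar matrix
    y rc; they span the image of B when B has rank 2 and y rc is non-zero. *)
Definition minor_frame rc y : 'M[K]_(4, 2) :=
  \matrix_(k, l) (if l == 0 then y (index_pair k (rc.1 1), rc.2)
                  else y (index_pair (rc.1 0) k, rc.2) : K).

Lemma minor_frameZ rc (c : K) y : minor_frame rc (c *: y) = c *: minor_frame rc y.
Proof. by apply/matrixP => k l; rewrite !mxE !ffunE; case: ifP. Qed.

Lemma minor_frame_minors rc (B : 'End(V)) :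
  exists N : 'M[K]_(4, 2), minor_frame rc (minors B) = mxe B *m N.
Proof.
set X := mxe B; set i := rc.1 0; set j := rc.1 1; set c := rc.2.
exists (\matrix_(k, l) if l == 0
  then (k == c 0)%:R * X j (c 1) - (k == c 1)%:R * X j (c 0)
  else (k == c 1)%:R * X i (c 0) - (k == c 0)%:R * X i (c 1)).
have cE : c = index_pair (c 0) (c 1).
  apply/ffunP => -[[|[|//]] hk]; rewrite ffunE /=; congr (c _); exact: val_inj.
have pick (k : 'I_4) a (b : K) : \sum_m X k m * ((m == a)%:R * b) = X k a * b.
  rewrite (bigD1 a) //= eqxx mul1r big1 ?addr0 // => m /negPf ->.
  by rewrite mul0r mulr0.
apply/matrixP => k l; rewrite [LHS]mxE [RHS]mxE !ffunE -/c -/i -/j {1 2}cE !minor2_pair -/X.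
under eq_bigr => m _ do rewrite [Y in _ * Y]mxE.
case: (l == 0) => /=; under eq_bigr => m _ do rewrite mulrBr.
  by rewrite sumrB !pick.
by rewrite sumrB !pick; ring.
Qed.

Lemma minor2_equal_rows (k : 'I_4) c B : minor2 e (index_pair k k, c) B = 0.
Proof.
have -> : c = index_pair (c 0) (c 1).
  apply/ffunP => -[[|[|//]] hk]; rewrite ffunE /=; congr (c _); exact: val_inj.
by rewrite minor2_pair; ring.
Qed.

Lemma minor_frame_left_inverse rc y : y rc != 0 ->
  (forall k, y (index_pair k k, rc.2) = 0) ->
  exists L, L *m minor_frame rc y = 1%:M.
Proof.
case: rc => r c /= yn0 y0; exists ((y (r, c) : K)^-1 *: rowsub r 1%:M).
rewrite -scalemxAl -rowsubE; apply/matrixP => k l; rewrite !mxE /=.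
have rE : index_pair (r 0) (r 1) = r.
  by apply/ffunP => -[[|[|//]] hk]; rewrite ffunE /=; congr (r _); apply: val_inj.
have r_ (a b : 'I_2) : val a = val b -> r a = r b by move=> /val_inj ->.
case: k => -[|[|//]] hk; case: l => -[|[|//]] hl /=.
- by rewrite (r_ (Ordinal hk) 0) // rE mulVf.
- by rewrite (r_ (Ordinal hk) 0) // y0 mulr0.
- by rewrite (r_ (Ordinal hk) 1) // y0 mulr0.
- by rewrite (r_ (Ordinal hk) 1) // rE mulVf.
Qed.

Lemma free_frame F L : L *m F = 1%:M ->
  free [:: (frame_of_mx e F).1; (frame_of_mx e F).2].
Proof.
move: (frame_of_mxK he F) => /esym; move: (frame_of_mx e F) => u FE LF.
apply/(@freeP _ _ 2 [tuple u.1; u.2]) => k; rewrite !big_ord_recl big_ord0 addr0 /= => k0.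
suff cE : \col_i k i = 0 by move=> i; have /matrixP/(_ i 0) := cE; rewrite !mxE.
rewrite -[LHS]mul1mx -LF -mulmxA (_ : F *m _ = 0) ?mulmx0 //.
rewrite -(cvec0 e) -k0 FE.
apply/matrixP => i j; rewrite !mxE !big_ord_recl big_ord0 addr0 !mxE /=.
by rewrite linearD !linearZ /= ![_ * k _]mulrC.
Qed.

Lemma frame_of_mx_span F F' N L L' : L *m F = 1%:M -> L' *m F' = 1%:M ->
  F' = F *m N -> forall B : 'End(V),
  frame_point (B, frame_of_mx e F') = frame_point (B, frame_of_mx e F).
Proof.
move=> LF LF' F'E B; rewrite /frame_point.
move: (free_frame LF) (free_frame LF') (frame_of_mxK he F) (frame_of_mxK he F').
move: (frame_of_mx e F) (frame_of_mx e F') => u u' fu fu' FE FE'.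
congr (_, _); rewrite /=.
apply/eqP; rewrite eqEdim; apply/andP; split; last first.
  by rewrite (eqP fu) (eqP fu').
have u1 : u.1 \in <<[:: u.1; u.2]>>%VS by rewrite memv_span ?mem_head.
have u2 : u.2 \in <<[:: u.1; u.2]>>%VS by rewrite memv_span // !inE eqxx orbT.
have -> : u' = (N 0 0 *: u.1 + N 1 0 *: u.2, N 0 1 *: u.1 + N 1 1 *: u.2).
  by rewrite -(framemx_mul he) FE -F'E -FE' framemxK.
by apply/span_subvP => x; rewrite !inE /= => /orP[] /eqP ->;
  apply: rpredD; apply: rpredZ.
Qed.

Lemma lagrangian_frame F L (B : 'End(V)) : isotropic_frame J F ->
  L *m F = 1%:M -> Z B -> mxe B *m F = 0 ->
  Ztilde_set omega (frame_point (B, frame_of_mx e F)).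
Proof.
move=> F0 LF ZB BF; have fu := free_frame LF; rewrite /frame_point /= in fu *.
set u := frame_of_mx e F in fu *.
have FE : F = framemx e u by rewrite frame_of_mxK.
have iso : isotropic omega <<[:: u.1; u.2]>>.
  rewrite /isotropic -(orthogonalE omega [:: u.1; u.2] [:: u.1; u.2]).
  have om k l : omega [:: u.1; u.2]`_(k : 'I_2) [:: u.1; u.2]`_(l : 'I_2) = 0.
    by rewrite -(coordmx_gram omega he (m := 2)) -/(framemx e u) -FE F0 mxE.
  apply/orthogonalP => x y; rewrite !inE => /orP[] /eqP -> /orP[] /eqP ->.
  - exact: (om 0 0).
  - exact: (om 0 1).
  - exact: (om 1 0).
  - exact: (om 1 1).
split=> //=.
  split=> // U' U'iso UU'; apply/esym/eqP; rewrite eqEdim UU' (eqP fu) /=.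
  exact: (isotropic_dim_le2 he homega U'iso).
have : framemx e (B u.1, B u.2) = framemx e (0, 0).
  rewrite -mul_framemx // -FE BF; apply/matrixP => i k; rewrite !mxE.
  by case: k => -[|[|//]] hk /=; rewrite linear0.
move/(can_inj (framemxK he)) => [B1 B2].
apply/eqP; rewrite -subv0 limg_span; apply/span_subvP => x.
by rewrite !inE /= => /orP[] /eqP ->; rewrite ?B1 ?B2 mem0v.
Qed.

Lemma minor_frame_of_frame rc F L (c : K) y : L *m F = 1%:M ->
  y = c *: frame_minors F -> y rc != 0 -> forall B : 'End(V),
  frame_point (B, frame_of_mx e (minor_frame rc y)) =
    frame_point (B, frame_of_mx e F).
Proof.
move=> LF yE yn0 B.
have [N NE] := minor_frame_minors rc (isym (F *m F^T)).
have [|L' LF'] := minor_frame_left_inverse yn0.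
  by move=> k; rewrite yE ffunE ffunE minor2_equal_rows scaler0.
apply: (frame_of_mx_span LF LF' (N := c *: (F^T *m J *m N))).
by rewrite yE minor_frameZ NE mxe_isym // -scalemxAr !mulmxA.
Qed.

Lemma polyfun_coord rc : polyfun (fun By : 'End(V) * E => (By.2 rc : K)).
Proof. by apply: polyfun_linear => a u v /=; rewrite !ffunE. Qed.

Lemma polymx_minor_frame rc :
  polymx (fun By : 'End(V) * E => minor_frame rc By.2).
Proof.
move=> k l; case l0: (l == 0).
  apply: eq_polyfun (polyfun_coord (index_pair k (rc.1 1), rc.2)) => By.
  by rewrite mxE l0.
apply: eq_polyfun (polyfun_coord (index_pair (rc.1 0) k, rc.2)) => By.
by rewrite mxE l0.
Qed.

Lemma polymx_mxe_fst : polymx (fun By : 'End(V) * E => mxe By.1).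
Proof.
move=> i j; apply: (@polyfun_comp _ _ _ fst (fun B => mxe B i j)).
  exact: polymap_lin.
exact: polymx_mxe.
Qed.

Lemma polyfun_frame_minors (W : vectType K) (A : W -> 'M[K]_(4, 2)) rc :
  polymx A -> polyfun (fun w => (frame_minors (A w) rc : K)).
Proof.
move=> hA; apply: (@eq_polyfun _ _ (fun w => \det (rowsub rc.1 (A w)) *
    \det (colsub rc.2 ((A w)^T *m J)))) => [w|]; first by rewrite frame_minorsE.
apply: polyfun_mul; apply: polyfun_det; apply: polymx_sub => //.
by apply: polymx_mul; [exact: polymx_tr|exact: polymx_const].
Qed.

Lemma frame_minorsZ (c : K) F : frame_minors (c *: F) = c ^+ 4 *: frame_minors F.
Proof. by rewrite -mul_mx_scalar frame_minors_mul det_scalar -exprM. Qed.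

(** The relations between B and its vector of minors which are to be extended to
    the blow-up; in the last one, both vectors are multiples of a third one
    because the minors of B come from a frame whose span contains the columns of
    minor_frame. *)
Lemma minor_frame_square_zero rc B : Z B ->
  [/\ isotropic_frame J (minor_frame rc (minors B)),
      mxe B *m minor_frame rc (minors B) = 0 &
      exists (F : 'M[K]_(4, 2)) (a b : K), minors B = a *: frame_minors F /\
        frame_minors (minor_frame rc (minors B)) = b *: frame_minors F].
Proof.
move=> /(square_zero_normal_form he homega)[F [L [s [F0 LF ss ->]]]].
set B' := isym _; have [N ->] := minor_frame_minors rc B'.
rewrite {1 3 4}mxe_isym // -!mulmxA; move: (s *m _) => N'.
have FN0 : F^T *m J *m (F *m N') = 0 by rewrite mulmxA (F0 : _ *m F = 0) mul0mx.
split.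
- by rewrite /isotropic_frame trmx_mul -!mulmxA (mulmxA F^T) FN0 mulmx0.
- by rewrite mxe_isym // -!mulmxA (mulmxA F^T) FN0 !mulmx0.
- exists F, (\det s), (\det N' ^+ 2).
  by rewrite minors_frame frame_minors_mul.
Qed.

(** Each conclusion rests on a relation homogeneous in y that holds for minors on
    Z, of degree 1, 2 or 5, so that it holds on the blow-up.  The one of degree 5
    is the proportionality of y and frame_minors (minor_frame rc y), the latter
    being quartic in y. *)
Lemma blowup_point_frame (B : 'End(V)) (l : {vspace E}) y rc :
  blowup_set Z (minor2 e) (B, l) -> y \in l -> y rc != 0 ->
  [/\ isotropic_frame J (minor_frame rc y),
      exists L, L *m minor_frame rc y = 1%:M,
      mxe B *m minor_frame rc y = 0 &
      exists c : K, c != 0 /\ frame_minors (minor_frame rc y) = c *: y].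
Proof.
move=> [_ _ /= rel] yl yn0.
have [L LF] : exists L, L *m minor_frame rc y = 1%:M.
  apply: minor_frame_left_inverse => // k.
  apply: (rel 1%N (fun By => By.2 (index_pair k k, rc.2))) yl.
  - exact: polyfun_coord.
  - by move=> x z c; rewrite ffunE expr1.
  - by move=> x _ /=; rewrite ffunE minor2_equal_rows.
have prop a b : (y a : K) * frame_minors (minor_frame rc y) b =
    (y b : K) * frame_minors (minor_frame rc y) a.
  apply/eqP; rewrite -subr_eq0; apply/eqP.
  apply: (rel 5%N (fun By =>
    (By.2 a : K) * frame_minors (minor_frame rc By.2) b -
    (By.2 b : K) * frame_minors (minor_frame rc By.2) a)) yl.
  - by apply: polyfun_sub; apply: polyfun_mul; try exact: polyfun_coord;
      apply: polyfun_frame_minors; apply: polymx_minor_frame.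
  - move=> x z c; rewrite /= minor_frameZ frame_minorsZ.
    by rewrite !coordZ; ring.
  - move=> x Zx /=; rewrite -/(minors x).
    have [_ _ [F [p [q [-> ->]]]]] := minor_frame_square_zero rc Zx.
    by rewrite !coordZ; ring.
split; last 1 first.
- exists (frame_minors (minor_frame rc y) rc / (y rc : K)); split.
    rewrite mulf_neq0 ?invr_neq0 //; apply: contraNneq (frame_minors_neq0 LF) => fm0.
    apply/eqP/ffunP => b; rewrite [RHS]ffunE; apply: (mulfI yn0).
    by rewrite prop fm0 !mulr0.
  apply/ffunP => b; rewrite coordZ; apply: (mulfI yn0).
  by rewrite prop; field.
- apply/matrixP => k m; rewrite [RHS]mxE.
  apply: (rel 2%N (fun By =>
    ((minor_frame rc By.2)^T *m J *m minor_frame rc By.2) k m)) yl.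
  - apply: polymx_mul; last exact: polymx_minor_frame.
    apply: polymx_mul; last exact: polymx_const.
    by apply: polymx_tr; apply: polymx_minor_frame.
  - move=> x z c; rewrite /= minor_frameZ.
    have -> : (c *: minor_frame rc z)^T = c *: (minor_frame rc z)^T by rewrite linearZ.
    by rewrite -!scalemxAl -scalemxAr scalerA -expr2 mxE.
  - by move=> x /(minor_frame_square_zero rc)[h _ _] /=; rewrite h mxE.
- by exists L.
- apply/matrixP => k m; rewrite [RHS]mxE.
  apply: (rel 1%N (fun By => (mxe By.1 *m minor_frame rc By.2) k m)) yl.
  - by apply: polymx_mul; [exact: polymx_mxe_fst|exact: polymx_minor_frame].
  - by move=> x z c; rewrite /= minor_frameZ -scalemxAr mxE expr1.
  - by move=> x /(minor_frame_square_zero rc)[_ h _] /=; rewrite h mxE.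
Qed.

Lemma frame_minors_span (u u' : V * V) L : L *m framemx e u' = 1%:M ->
  <<[:: u'.1; u'.2]>>%VS = <<[:: u.1; u.2]>>%VS ->
  <[frame_minors (framemx e u')]>%VS = <[frame_minors (framemx e u)]>%VS.
Proof.
move=> LF' spE.
have comb x : x \in <<[:: u'.1; u'.2]>>%VS -> exists a b, x = a *: u.1 + b *: u.2.
  rewrite spE span_cons span_seq1.
  by move=> /memv_addP[_ /vlineP[a ->] [_ /vlineP[b ->] ->]]; exists a, b.
have [|a [b u1]] := comb u'.1; first by rewrite memv_span ?mem_head.
have [|c [d u2]] := comb u'.2; first by rewrite memv_span // !inE eqxx orbT.
pose N : 'M[K]_2 := \matrix_(i, j) if j == 0 then if i == 0 then a else b
  else if i == 0 then c else d.
have FE : framemx e u' = framemx e u *m N.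
  apply: (can_inj (frame_of_mxK he)); rewrite framemx_mul // framemxK //.
  by rewrite !mxE /= -u1 -u2 -surjective_pairing.
have dN : \det N ^+ 2 != 0.
  apply: contraTneq (oner_neq0 K) => d0; rewrite -(det1 K 2) -LF' FE mulmxA.
  by rewrite det_mulmx; move/eqP: d0; rewrite sqrf_eq0 => /eqP ->; rewrite mulr0 eqxx.
rewrite FE frame_minors_mul; apply/eqP; rewrite eqEsubv -!memvE.
rewrite rpredZ ?memv_line //=; apply/vlineP; exists (\det N ^+ 2)^-1.
by rewrite scalerA mulVf // scale1r.
Qed.

Local Notation Zt := (Ztilde omega).
Local Notation Bl := (blowup Z (minor2 e)).

(** The graphs of the two maps in coordinates, for all choices of a frame, of
    homogeneous coordinates and of a non-vanishing minor.  Quantifying over the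
    choices makes the maps independent of them and provides the local polynomial
    lifts. *)
Definition lifts_minors (x : Zt) (p : Bl) : Prop :=
  forall w : 'End(V) * (V * V), frame_point w = val (x : Ztilde_set omega) ->
    val (p : blowup_set Z (minor2 e)) = line_point (w.1, frame_minors (framemx e w.2)).

Definition lifts_minor_frame (p : Bl) (x : Zt) : Prop :=
  forall w : 'End(V) * E, line_point w = val (p : blowup_set Z (minor2 e)) ->
    forall rc, w.2 rc != 0 ->
    val (x : Ztilde_set omega) = frame_point (w.1, frame_of_mx e (minor_frame rc w.2)).

Lemma Ztilde_point (x : Zt) (w : 'End(V) * (V * V)) :
  frame_point w = val (x : Ztilde_set omega) -> exists L s,
  [/\ isotropic_frame J (framemx e w.2), L *m framemx e w.2 = 1%:M, s^T = s &
      w.1 = isym (framemx e w.2 *m s *m (framemx e w.2)^T)].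
Proof.
case: w => B u wx; have := set_valP (x : Ztilde_set omega); rewrite -wx => Zx.
have fu : free [:: u.1; u.2].
  have [_ /(dim_maximal_isotropic he homega) dU _] := Zx.
  exact/eqP/dU.
have [F0 [s [ss BE]]] := Ztilde_frame he homega fu Zx.
by have [L LF] := framemx_left_inverse he fu; exists L, s.
Qed.

Lemma Ztilde_has_frame (x : Zt) :
  exists w : 'End(V) * (V * V), frame_point w = val (x : Ztilde_set omega).
Proof.
have := set_valP (x : Ztilde_set omega); case: (val _) => B U [_ Umax _].
have [u [_ /= UE]] := maximal_isotropic_frame he homega Umax.
by exists (B, u); rewrite /frame_point /= -UE.
Qed.

Lemma blowup_has_line (p : Bl) : exists (w : 'End(V) * E) rc,
  line_point w = val (p : blowup_set Z (minor2 e)) /\ w.2 rc != 0.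
Proof.
have := set_valP (p : blowup_set Z (minor2 e)).
case: (val _) => B l [_ /= dl _].
have ln0 : vpick l != 0 by rewrite vpick0 -dimv_eq0 dl.
have lE : l = <[vpick l]>%VS.
  apply/esym/eqP; rewrite eqEdim -memvE memv_pick dl dim_vline ln0.
  by [].
have [rc hrc] : exists rc, vpick l rc != 0.
  apply/existsP; rewrite -negb_forall; apply: contra ln0 => /forallP h.
  by apply/eqP/ffunP => rc; rewrite ffunE; apply/eqP.
by exists (B, vpick l), rc; rewrite /line_point /= -lE.
Qed.

Lemma exists_lifts_minors (x : Zt) : exists p, lifts_minors x p.
Proof.
have [w wx] := Ztilde_has_frame x.
have [L [s [F0 LF ss BE]]] := Ztilde_point wx.
have hp : blowup_set Z (minor2 e) (line_point (w.1, frame_minors (framemx e w.2))).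
  split=> /=.
  - rewrite BE; apply/square_zero_sym => //; exact: sqzero_frame.
  - by rewrite dim_vline (frame_minors_neq0 LF).
  - move=> d P Pp Ph P0 y yl; rewrite BE.
    exact: (minors_square_zero_frame 0 F0 ss yl Pp Ph P0).
exists (SigSub (mem_set hp)) => w' w'x /=.
have [L' [s' [_ LF' _ _]]] := Ztilde_point w'x.
move: w'x; rewrite -wx => -[-> spE]; congr (_, _) => /=.
by apply/esym/(frame_minors_span LF' spE).
Qed.

Lemma lift_minor_frame (p : Bl) (w w' : 'End(V) * E) rc rc' :
  line_point w = val (p : blowup_set Z (minor2 e)) ->
  line_point w' = val (p : blowup_set Z (minor2 e)) ->
  w.2 rc != 0 -> w'.2 rc' != 0 ->
  frame_point (w'.1, frame_of_mx e (minor_frame rc' w'.2)) =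
    frame_point (w.1, frame_of_mx e (minor_frame rc w.2)).
Proof.
case: w w' => [B y] [B' y'] wp w'p /= yn0 yn0'.
have := set_valP (p : blowup_set Z (minor2 e)); rewrite -wp => Bp.
have [F0 [L LF] BF [c [cn0 FE]]] := blowup_point_frame Bp (memv_line y) yn0.
move: w'p; rewrite -wp => w'w; rewrite (congr1 fst w'w : B' = B).
have lE := congr1 snd w'w; rewrite /= in lE.
have /vlineP[b y'E] : y' \in <[y]>%VS by rewrite -lE memv_line.
apply: (minor_frame_of_frame LF (c := b / c)) => //.
by rewrite FE scalerA divfK.
Qed.

Lemma exists_lifts_minor_frame (p : Bl) : exists x, lifts_minor_frame p x.
Proof.
have [w [rc [wp wn0]]] := blowup_has_line p.
have := set_valP (p : blowup_set Z (minor2 e)); rewrite -wp => Bp.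
have [F0 [L LF] BF _] := blowup_point_frame Bp (memv_line w.2) wn0.
have [ZB _ _] := Bp.
have hx := lagrangian_frame F0 LF ZB BF.
exists (SigSub (mem_set hx)) => w' w'p rc' wn0'.
by rewrite (lift_minor_frame wp w'p wn0 wn0').
Qed.

Lemma lifts_minors_morphism (phi : Zt -> Bl) :
  (forall x, lifts_minors x (phi x)) -> is_morphism phi.
Proof.
move=> phiP; apply: local_lift_morphism => x w wx.
exists (fun w => (w.1, frame_minors (framemx e w.2))), (fun _ => 1).
split; last 1 first.
- by move=> x' w' w'x _; rewrite (phiP x' w' w'x).
- apply: polymap_pair; first exact: polymap_lin.
  apply: (@polymap_sum K _ E minor_index
    (fun rc (v : 'End(V) * (V * V)) => (frame_minors (framemx e v.2) rc : K))
    (fun rc => [ffun rc' => ((rc' == rc)%:R : K^o)] : E)) => [v|rc].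
    apply/ffunP => rc; rewrite sum_ffunE (bigD1 rc) //= coordZ [X in _ * X + _]ffunE eqxx mulr1.
    rewrite big1 ?addr0 // => rc' /negPf ne.
    by rewrite coordZ [X in _ * X]ffunE eq_sym ne mulr0.
  apply: polyfun_frame_minors => i k.
  apply: polyfun_linear => a u v; rewrite !mxE.
  by case: k => -[|[|//]] hk /=; rewrite linearP.
- exact: polyfun_const.
- exact: oner_neq0.
Qed.

Lemma lifts_minor_frame_morphism (psi : Bl -> Zt) :
  (forall p, lifts_minor_frame p (psi p)) -> is_morphism psi.
Proof.
move=> psiP; apply: local_lift_morphism => p w wp.
have [w0 [rc0 [wp0 wn0]]] := blowup_has_line p.
have [rc wn] : exists rc, w.2 rc != 0.
  apply/existsP; rewrite -negb_forall; apply/negP => /forallP h.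
  have w0' : w.2 = 0 by apply/ffunP => rc; rewrite [RHS]ffunE; apply/eqP.
  have lE := congr1 snd (etrans wp (esym wp0)); rewrite /= in lE.
  have : w0.2 \in <[w.2]>%VS by rewrite lE memv_line.
  rewrite w0' => /vlineP[c]; rewrite scaler0 => w00.
  by move: wn0; rewrite w00 ffunE eqxx.
exists (fun v : 'End(V) * E => (v.1, frame_of_mx e (minor_frame rc v.2))),
  (fun v : 'End(V) * E => (v.2 rc : K)).
split=> //.
- apply: polymap_pair; first exact: polymap_lin.
  by apply: polymap_pair; apply: polymap_vecc => i j;
    apply: eq_polyfun (polymx_minor_frame rc i _) => v; rewrite [RHS]mxE.
- exact: polyfun_coord.
- by move=> p' w' w'p w'n; rewrite (psiP p' w' w'p rc w'n).
Qed.

Lemma resolution_isomorphic_blowup :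
  exists phi : Zt -> Bl, is_isomorphism phi /\ forall x, blowdown (phi x) = sigma x.
Proof.
have [phi phiP] := choice exists_lifts_minors.
have [psi psiP] := choice exists_lifts_minor_frame.
exists phi; split; last first.
  move=> x; have [w wx] := Ztilde_has_frame x.
  by rewrite /blowdown /sigma (phiP x w wx) -wx.
split; first exact: lifts_minors_morphism.
exists psi; split; first exact: lifts_minor_frame_morphism.
- move=> x; apply: val_inj; have [w wx] := Ztilde_has_frame x.
  have [L [s [F0 LF _ _]]] := Ztilde_point wx.
  have [rc hrc] : exists rc, frame_minors (framemx e w.2) rc != 0.
    apply/existsP; rewrite -negb_forall.
    apply: contra (frame_minors_neq0 LF) => /forallP h.
    by apply/eqP/ffunP => rc; rewrite [RHS]ffunE; apply/eqP.
  have /= := psiP (phi x) (w.1, frame_minors (framemx e w.2)) (esym (phiP x w wx)) rc hrc.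
  by move=> ->; rewrite (minor_frame_of_frame LF (c := 1)) ?scale1r // framemxK.
- move=> p; apply: val_inj; have [w [rc [wp wn0]]] := blowup_has_line p.
  have := set_valP (p : blowup_set Z (minor2 e)); rewrite -wp => Bp.
  have [F0 [L LF] BF [c [cn0 FE]]] := blowup_point_frame Bp (memv_line w.2) wn0.
  have := phiP (psi p) (w.1, frame_of_mx e (minor_frame rc w.2)).
  rewrite (psiP p w wp rc wn0) => /(_ erefl) /= ->.
  rewrite frame_of_mxK // FE; congr (_, _) => /=.
  apply/eqP; rewrite eqEsubv -!memvE rpredZ ?memv_line //=.
  by apply/vlineP; exists c^-1; rewrite scalerA mulVf // scale1r.
Qed.

End BlowUp.

Theorem mainTheorem2 (R : realType) (V : vectType R[i])
    (omega : {skew_symmetric V}) (e : 4.-tuple V)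
    (hdim : \dim {:V} = 4%N) (homega : is_psymplectic omega)
    (he : basis_of {:V} e) :
  generates_ideal (sp_alg omega) (singular_locus (square_zero omega))
    (minor2 e) /\
  (exists phi : Ztilde omega -> blowup (square_zero omega) (minor2 e),
     is_isomorphism phi /\ forall p, blowdown (phi p) = sigma p).
Proof.
have [nondeg _ _] := homega; split; last exact: (resolution_isomorphic_blowup he nondeg).
move=> g hg; split=> [g0|[a [_ ha]] B singB].
  apply: (veronese_ideal he nondeg hg) => v.
  by apply: g0; apply: (singular_isym_outer he nondeg).
have [[spB BB] _] := singB; rewrite ha // big1 // => rc _.
have [F [L [s [F0 LF ss BE]]]] := square_zero_normal_form he nondeg (conj spB BB).
move: singB; rewrite BE => /(singular_det0 he nondeg F0 LF ss) s0.
by rewrite (minor2_frame omega he) s0 mul0r mulr0.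
Qed.
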